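(* Let $m\ge 1$ be an integer, and let $\pi\in\mathfrak{S}_{m,n}$ be chosen uniformly at random. If $n$ is sufficiently large in terms of $m$, then $$\mathbb{E}[L_{m,n}(\pi)]=\Gamma^{-1}(n)+\Theta\left(1+\frac{\log m}{\log(\Gamma^{-1}(n))}\,\Gamma^{-1}(n)\right),$$ where $\Gamma^{-1}(n)$ is the inverse of the gamma function when restricted to $x\ge 1$.
   Context: For positive integers $m,n$, $\mathfrak{S}_{m,n}$ is the set of words $\pi$ of length $mn$ which use each integer in $[n]=\{1,\ldots,n\}$ exactly $m$ times. For $\pi\in\mathfrak{S}_{m,n}$, $L_{m,n}(\pi)$ is the length of a longest (not necessarily contiguous) subsequence of $\pi$ of the form $i(i+1)(i+2)\cdots j$ for some integers $i\le j$. Here $\log$ is the natural logarithm and $\Gamma$ is the gamma function, which satisfies $\Gamma(k)=(k-1)!$ for positive integers $k$; for an integer $n\ge 2$, $\Gamma^{-1}(n)$ is the unique real $x\ge 1$ with $\Gamma(x)=n$. *)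

(* Defs.v *)
From HB Require Import structures.
From mathcomp Require Import all_boot all_order all_algebra.
From mathcomp Require Import all_classical all_reals all_analysis.

Set Implicit Arguments.
Unset Strict Implicit.
Unset Printing Implicit Defensive.

Import Order.TTheory GRing.Theory Num.Theory.

Local Open Scope classical_set_scope.
Local Open Scope ring_scope.

(* The alphabet {1, ..., n} is represented by 'I_n, i.e. {0, ..., n - 1}; the
   shift by one does not change which words are runs of consecutive integers. *)
Definition multiset_words (m n : nat) : {set (m * n).-tuple 'I_n} :=
  [set w : (m * n).-tuple 'I_n | [forall i : 'I_n, count_mem i w == m]]%SET.

(* [index_iota i j.+1] is the sequence i, i + 1, ..., j. *)
Definition longest_run (n : nat) (w : seq 'I_n) : nat :=
  (\max_(i < n)
    \max_(j < n | (i <= j)%N && subseq (index_iota i j.+1) (map val w))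
      size (index_iota i j.+1))%N.

(* Expectation of the longest run over a uniformly random element of
   [multiset_words m n]. *)
Definition expected_longest_run (R : realType) (m n : nat) : R :=
  (\sum_(w in multiset_words m n) (longest_run w)%:R) /
  #|multiset_words m n|%:R.

Definition Gamma (R : realType) (x : R) : R :=
  \int[lebesgue_measure]_(t in `]0, +oo[) (t `^ (x - 1) * expR (- t)).

(* For 2 <= n the set below is a singleton; 1 is only a default value.
   For n = 1 it is {1, 2}, as Gamma 1 = Gamma 2 = 1. *)
Definition inv_Gamma (R : realType) (n : nat) : R :=
  xget 1 [set x : R | 1 <= x /\ Gamma x = n%:R].

(* Main.v *)
Require Import Defs.
From mathcomp Require Import all_boot all_order all_algebra all_fingroup.
From mathcomp Require Import zify.

(** Let [x] be the inverse Gamma value of [n] and [j] its integer part.  Since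
    Gamma is convex and interpolates the factorials, [n] lies between [(j-1)!]
    and [j!], and below the chord joining them at [x]
    ([inv_Gamma_itv]).  The rest compares [n] with factorials.

    Symmetry.  Fix [k] letters.  Relabelling them by any permutation preserves
    the uniform distribution on words, so averaging over all [k!] relabellings
    shows that they occur in increasing order with probability [E[D] / k!],
    where [D] is the number of orderings of these letters that are subsequences
    of the word.  An ordering is determined by the copies of the letters that
    realise it, so [D <= m ^ k] ([card_contains]).

    Upper bound.  The expected number of runs of length [k] is therefore at most
    [n * m ^ k / k!], which falls below [1] once [k!] exceeds [n * m ^ k]; for
    [n] close to [j!] this happens at [k = j + O(j * log m / log j)].

    Lower bound.  Cut the alphabet into [N] disjoint blocks of [k] consecutive
    letters and relabel inside every block independently.  Given the orbit of
    the word, the blocks are independent, so no block is increasing with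
    probability [E[\prod_a (1 - D_a / k!)]] ([card_avoid]).  It remains to bound
    [D_a] from below.  Cut the positions of the word into windows.  Choosing for
    every letter one of the windows that it meets determines an ordering, and
    few choices share an ordering because, read along the ordering, the windows
    are nondecreasing ([prod_pieces_le]).  With about [sqrt j] windows, most
    letters of most words have their [m] copies in [m] different windows
    ([sum_crowded]), hence [D_a] is at least [m ^ (k / 2)] up to a factor
    [exp (O (sqrt j * log j))] for half of the blocks.  This allows
    [k = j + j * log m / (8 * log j)].

    The case [m = 1] asks for more than an upper bound: the difference must stay
    away from [0].  Bounding the probability of a run of length [j] by [n / j!],
    and [n] by the chord, gives an expectation of at most [x - 1 + O (1 / j)].
    For [m > 1] the difference is positive and of order
    [x * log m / log x]. *)

Set Implicit Arguments.
Unset Strict Implicit.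
Unset Printing Implicit Defensive.

Local Open Scope nat_scope.

(** * Orderings of letters inside a word *)

Definition order_rank k L (h : 'I_k -> 'I_L) (b : 'I_k) : nat :=
  #|[set b' | h b' < h b]|.

Lemma order_rank_ltn k L (h : 'I_k -> 'I_L) b : order_rank h b < k.
Proof.
rewrite -[X in _ < X]card_ord -cardsT; apply: proper_card.
rewrite properE subsetT /=; apply/subsetPn; exists b; first by rewrite inE.
by rewrite inE ltnn.
Qed.

Lemma order_rank_mono k L (h : 'I_k -> 'I_L) b b' :
  h b < h b' -> order_rank h b < order_rank h b'.
Proof.
move=> lt_h; apply: proper_card; rewrite properE; apply/andP; split.
  by apply/subsetP => c; rewrite !inE => /ltn_trans; apply.
by apply/subsetPn; exists b; rewrite !inE ?lt_h ?ltnn.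
Qed.

(** Hence at most one permutation sorts [h]: the inverse of its rank function. *)
Lemma order_rank_increasing k L (h : 'I_k -> 'I_L) (s : {perm 'I_k}) :
  (forall i j : 'I_k, i < j -> h (s i) < h (s j)) ->
  forall i, order_rank h (s i) = i.
Proof.
move=> incr i; have -> : order_rank h (s i) = #|[set s j | j in [set j : 'I_k | j < i]]|.
  congr #|pred_of_set _|; apply/setP => b; rewrite inE.
  rewrite -{1}(permKV s b); apply/idP/imsetP => [lt_h | [j]].
    exists (s^-1 b)%g; rewrite ?permKV // inE ltnNge; apply/negP.
    rewrite leq_eqVlt => /orP[/eqP/val_inj eq_i|/incr]; last by lia.
    by move: lt_h; rewrite -eq_i ltnn.
  by rewrite inE => lt_ji ->; rewrite permK; apply: incr.
rewrite card_imset; last exact: perm_inj.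
have -> : [set j : 'I_k | j < i] = [set widen_ord (ltnW (ltn_ord i)) j | j in 'I_i].
  apply/setP => j; rewrite inE; apply/idP/imsetP => [lt_ji|[a _ ->] /=].
    by exists (Ordinal lt_ji) => //; apply: val_inj.
  exact: ltn_ord.
rewrite card_imset ?card_ord // => a a' /(congr1 val) /= /val_inj //.
Qed.

Lemma sorting_perm k L (h : 'I_k -> 'I_L) : injective h ->
  exists s : {perm 'I_k}, forall i j : 'I_k, i < j -> h (s i) < h (s j).
Proof.
move=> inj_h; pose r b := Ordinal (order_rank_ltn h b).
have inj_r : injective r.
  move=> b b' /(congr1 val) /= eq_r; apply: inj_h; apply: val_inj.
  by case: (ltngtP (h b) (h b')) => // /order_rank_mono; rewrite eq_r ltnn.
exists (perm inj_r)^-1%g => i j lt_ij.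
have rK a : order_rank h ((perm inj_r)^-1%g a) = a.
  by rewrite -[in RHS](permKV (perm inj_r) a) permE.
rewrite ltnNge leq_eqVlt; apply/negP => /orP[/eqP/val_inj/inj_h/perm_inj eq_ji|].
  by rewrite eq_ji ltnn in lt_ij.
by move/order_rank_mono; rewrite !rK ltnNge ltnW.
Qed.

Section Word.
Variables (n L k : nat) (w : L.-tuple 'I_n).

(** A placement picks one copy of each of the letters [t b]; sorting its positions
    turns it into an ordering of these letters that is a subsequence of [w]. *)
Definition placements (t : 'I_k -> 'I_n) : {set {ffun 'I_k -> 'I_L}} :=
  [set h : {ffun 'I_k -> 'I_L} | [forall b, tnth w (h b) == t b]].

Definition orderings (t : 'I_k -> 'I_n) : {set {perm 'I_k}} :=
  [set s : {perm 'I_k} | subseq [seq t (s b) | b <- enum 'I_k] w].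

Lemma in_placements t (h : {ffun 'I_k -> 'I_L}) :
  reflect (forall b, tnth w (h b) = t b) (h \in placements t).
Proof. by rewrite inE; apply: (iffP forallP) => eq_h b; apply/eqP/eq_h. Qed.

Lemma placements_inj t (h : {ffun 'I_k -> 'I_L}) : injective t ->
  h \in placements t -> injective h.
Proof.
by move=> inj_t /in_placements th b b' eq_h; apply: inj_t; rewrite -!th eq_h.
Qed.

Lemma orderingsP t (s : {perm 'I_k}) :
  reflect (exists2 h, h \in placements t &
             forall i j : 'I_k, i < j -> h (s i) < h (s j))
          (s \in orderings t).
Proof.
have ltT : transitive (fun i j : 'I_L => i < j) by move=> a b c; apply: ltn_trans.
have ltI : irreflexive (fun i j : 'I_L => i < j) by move=> a; apply: ltnn.
have sorted_enum (p : nat) : sorted (fun i j : 'I_p => i < j) (enum 'I_p).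
  have := iota_ltn_sorted 0 p; rewrite -val_enum_ord sorted_map.
  exact: sub_sorted.
have wE : w = [seq tnth w p | p <- enum 'I_L] :> seq _ by rewrite map_tnth_enum.
rewrite inE; apply: (iffP idP) => [|[h /in_placements th incr]].
  rewrite wE => /subseqP[mk sz_mk]; rewrite -map_mask; set p := mask _ _ => eq_p.
  have sz_p : size p = k.
    by move/(congr1 size): eq_p; rewrite 2!size_map -cardE card_ord.
  have srt_p : sorted (fun i j : 'I_L => i < j) p.
    exact: (sorted_mask ltT) (sorted_enum L).
  have szP : size p == k by rewrite sz_p.
  have nthE p0 (i : 'I_k) : tnth (Tuple szP) i = nth p0 p i by rewrite (tnth_nth p0).
  exists [ffun b => tnth (Tuple szP) ((s^-1)%g b)].
    apply/in_placements => b; rewrite ffunE.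
    rewrite -[in RHS](permKV s b); set a := (s^-1)%g b.
    have p0 := tnth (Tuple szP) a.
    have := congr1 (fun u => nth (t b) u a) eq_p.
    rewrite (nth_map a) -?cardE ?card_ord // nth_ord_enum => ->.
    by rewrite (nth_map p0) ?sz_p // (nthE p0).
  move=> i j lt_ij; rewrite !ffunE !permK.
  have p0 := tnth (Tuple szP) i; rewrite !(nthE p0).
  by apply: (sorted_ltn_nth ltT p0 srt_p); rewrite ?inE ?sz_p.
rewrite [X in subseq X](_ : _ = [seq tnth w (h (s b)) | b <- enum 'I_k]); last first.
  by apply: eq_map => b; rewrite th.
rewrite wE (map_comp (tnth w)); apply: map_subseq.
set p := [seq h (s b) | b <- _].
suff -> : p = filter (mem p) (enum 'I_L) by apply: filter_subseq.
apply: (irr_sorted_eq ltT ltI).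
- rewrite sorted_map; apply: sub_sorted (sorted_enum k) => i j; exact: incr.
- apply: (sorted_filter ltT); exact: sorted_enum.
- by move=> q; rewrite mem_filter /= mem_enum andbT.
Qed.

(** An ordering is recovered from any placement that realises it, by sorting. *)
Lemma card_orderings_le t : injective t -> #|orderings t| <= #|placements t|.
Proof.
move=> inj_t; pose R (s : {perm 'I_k}) (h : {ffun 'I_k -> 'I_L}) :=
  [forall i : 'I_k, forall j : 'I_k, (i < j) ==> (h (s i) < h (s j))].
have RP (s : {perm 'I_k}) (h : {ffun 'I_k -> 'I_L}) :
    reflect (forall i j : 'I_k, i < j -> h (s i) < h (s j)) (R s h).
  apply: (iffP 'forall_forallP) => H i j; last by apply/implyP/H.
  by move=> lt_ij; apply: (implyP (H i j)).
pose F (h : {ffun 'I_k -> 'I_L}) := odflt 1%g [pick s | R s h].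
apply: leq_trans (leq_imset_card F _); apply/subset_leq_card/subsetP => s.
move=> /orderingsP[h th /RP Rsh]; apply/imsetP; exists h => //; rewrite /F.
case: pickP => [s' /= /RP Rs'h | /(_ s)]; last by rewrite Rsh.
apply/permP => i; have rs := order_rank_increasing (elimT (RP _ _) Rsh).
have rs' := order_rank_increasing Rs'h.
by rewrite -{1}(permKV s' (s i)); congr (s' _); apply: val_inj; rewrite /= -rs' permKV rs.
Qed.

Lemma card_placements t :
  #|placements t| = \prod_(b < k) count_mem (t b) w.
Proof.
pose Fam b : {set 'I_L} := [set p | tnth w p == t b].
have -> : #|placements t| = #|family (fun b => mem (Fam b))|.
  rewrite cardsE; apply: eq_card => h; rewrite !inE.
  by apply/forallP/familyP => H b; have := H b; rewrite !inE.
rewrite card_family foldrE big_map big_enum /=; apply: eq_bigr => b _.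
rewrite -[in RHS](map_tnth_enum w) count_map cardsE cardE size_filter /=.
by rewrite enumT; apply: eq_count.
Qed.

End Word.

(** * Many orderings from letters spread over many windows *)

(** The map [c] colours the positions of [w], and will be the map from positions to
    windows. *)
Section Pieces.
Variables (n L k M : nat) (w : L.-tuple 'I_n) (c : 'I_L -> 'I_M.+1).

Definition pieces_of (x : 'I_n) : {set 'I_M.+1} :=
  [set c p | p in [set p | tnth w p == x]].

Definition nondecreasing_maps : {set {ffun 'I_k -> 'I_M.+1}} :=
  [set q : {ffun 'I_k -> 'I_M.+1} |
     [forall i : 'I_k, forall j : 'I_k, (i <= j) ==> (q i <= q j)]].

(** Nondecreasing maps are multisets of colours, hence counted by a binomial
    coefficient; the bound is polynomial in [k] for fixed [M]. *)
Lemma card_nondecreasing_maps_le : #|nondecreasing_maps| <= (k + M) ^ M.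
Proof.
apply: (@leq_trans 'C(k + M, k)).
  rewrite -card_sorted_tuples -(card_imset _ (can_inj (@finfun_of_tupleK 'I_M.+1 k))).
  apply/subset_leq_card/subsetP => q; rewrite inE => /forallP q_mono.
  apply/imsetP; exists (tuple_of_finfun q); last by rewrite tuple_of_finfunK.
  rewrite inE sorted_map /= sorted_map.
  have : sorted (fun i j : 'I_k => i <= j) (enum 'I_k).
    by have := iota_sorted 0 k; rewrite -val_enum_ord sorted_map.
  apply: sub_sorted => i j /= le_ij.
  by have /forallP/(_ j)/implyP := q_mono i; apply.
apply: (@leq_trans ((k + M) ^_ M)).
  rewrite -bin_sub ?leq_addr // addKn -bin_ffact leq_pmulr ?fact_gt0 //.
rewrite ffact_prod -[X in _ <= _ ^ X](card_ord M) -prod_nat_const.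
by apply: leq_prod => i _; apply: leq_subr.
Qed.

(** A choice of one colour per letter is realised by a placement [h].  If [s] sorts
    [h], the colours read along [s] are nondecreasing as [c] is monotone, and the
    choice can be read off from [s] and this nondecreasing map. *)
Lemma prod_pieces_le (t : 'I_k -> 'I_n) : injective t ->
  (forall p p' : 'I_L, p <= p' -> c p <= c p') ->
  \prod_(b < k) #|pieces_of (t b)| <= #|orderings w t| * #|nondecreasing_maps|.
Proof.
move=> inj_t c_mono.
have -> : \prod_(b < k) #|pieces_of (t b)| = #|family (fun b => mem (pieces_of (t b)))|.
  by rewrite card_family foldrE big_map big_enum.
rewrite -cardsX -(cardsE (family _)).
pose F (u : {perm 'I_k} * {ffun 'I_k -> 'I_M.+1}) := [ffun b => u.2 (u.1^-1 b)%g].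
apply: leq_trans (leq_imset_card F _); apply/subset_leq_card/subsetP => g.
rewrite inE => /familyP g_pieces.
have /fin_all_exists [h hP] b : exists p, (tnth w p == t b) && (c p == g b).
  have := g_pieces b; rewrite /= => /imsetP[p]; rewrite inE => wp ->.
  by exists p; rewrite wp eqxx.
have h_pl : finfun h \in placements w t.
  by apply/in_placements => b; rewrite ffunE; case/andP: (hP b) => /eqP.
have [s s_incr] := sorting_perm (placements_inj inj_t h_pl).
apply/imsetP; exists (s, [ffun i => g (s i)]); last first.
  by apply/ffunP => b; rewrite !ffunE /= permKV.
rewrite inE /=; apply/andP; split; first by apply/orderingsP; exists (finfun h).
rewrite inE; apply/'forall_forallP => i j; apply/implyP; rewrite !ffunE.
have cg b : c (h b) = g b by case/andP: (hP b) => _ /eqP.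
rewrite leq_eqVlt => /orP[/eqP/val_inj -> //|lt_ij]; rewrite -!cg.
by apply: c_mono; have := s_incr _ _ lt_ij; rewrite !ffunE => /ltnW.
Qed.
End Pieces.

(** * Averaging over relabellings *)

Lemma count_multiset_words m n (w : (m * n).-tuple 'I_n) x :
  w \in multiset_words m n -> count_mem x w = m.
Proof. by rewrite inE => /forallP/(_ x)/eqP. Qed.

Lemma relabel_multiset_words m n (s : {perm 'I_n}) (w : (m * n).-tuple 'I_n) :
  (map_tuple s w \in multiset_words m n) = (w \in multiset_words m n).
Proof.
rewrite !inE; apply/forallP/forallP => H x; last first.
  apply/eqP; apply: etrans (eqP (H (s^-1 x)%g)); rewrite /= count_map; apply: eq_count => y /=.
  by rewrite (can2_eq (permK s) (permKV s)).
apply/eqP; apply: etrans (eqP (H (s x))); rewrite /= count_map; apply: eq_count => y /=.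
by rewrite (inj_eq perm_inj).
Qed.

Lemma sum_relabel m n (s : {perm 'I_n}) (F : (m * n).-tuple 'I_n -> nat) :
  \sum_(w in multiset_words m n) F (map_tuple s w) = \sum_(w in multiset_words m n) F w.
Proof.
rewrite [RHS](reindex_inj (h := map_tuple s)) /=; last first.
  by move=> w w' /(congr1 val) /= /(inj_map perm_inj)/val_inj.
by apply: eq_bigl => w; rewrite relabel_multiset_words.
Qed.

(** The images of the [f a] are disjoint blocks of [k] letters; a family of
    permutations acts on the alphabet by permuting each block and fixing the
    letters outside of the blocks. *)
Section Blocks.
Variables (A : finType) (n k : nat) (f : A -> 'I_k -> 'I_n).
Hypothesis f_inj : injective (fun ab => f ab.1 ab.2).

Definition shuffle_fun (s : {ffun A -> {perm 'I_k}}) (x : 'I_n) : 'I_n :=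
  if [pick ab : A * 'I_k | f ab.1 ab.2 == x] is Some ab then f ab.1 (s ab.1 ab.2) else x.

Lemma shuffle_funE s a b : shuffle_fun s (f a b) = f a (s a b).
Proof.
rewrite /shuffle_fun; case: pickP => [ab /= /eqP eq_f|/(_ (a, b))]; last by rewrite eqxx.
by have := @f_inj ab (a, b) eq_f => ->.
Qed.

Lemma shuffle_fun_inj s : injective (shuffle_fun s).
Proof.
apply: (can_inj (g := shuffle_fun [ffun a => (s a)^-1%g])) => x.
rewrite {2}/shuffle_fun; case: pickP => [[a b] /= /eqP <-|nf].
  by rewrite shuffle_funE ffunE permK.
by rewrite /shuffle_fun; case: pickP => // ab; rewrite nf.
Qed.

Definition shuffle s : {perm 'I_n} := perm (@shuffle_fun_inj s).

Lemma shuffleE s a b : shuffle s (f a b) = f a (s a b).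
Proof. by rewrite permE shuffle_funE. Qed.

Lemma subseq_map_perm (s : {perm 'I_n}) u (w : seq 'I_n) :
  subseq u (map (s^-1)%g w) = subseq (map s u) w.
Proof.
apply/idP/idP => [/(map_subseq s)|/(map_subseq (s^-1)%g)].
  by rewrite (mapK (permKV s)).
by rewrite (mapK (permK s)).
Qed.

(** Given a word, the relabellings of different blocks are independent, and block
    [a] avoids the increasing order for all but [#|orderings w (f a)|] of the [k`!]
    permutations of that block. *)
Lemma card_avoid m :
  #|[set w in multiset_words m n |
     [forall a, ~~ subseq [seq f a b | b <- enum 'I_k] w]]| * k`! ^ #|A|
  = \sum_(w in multiset_words m n) \prod_a (k`! - #|orderings w (f a)|).
Proof.
pose F (w : (m * n).-tuple 'I_n) : nat :=
  \prod_a (~~ subseq [seq f a b | b <- enum 'I_k] w : nat).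
have -> : #|[set w in multiset_words m n |
     [forall a, ~~ subseq [seq f a b | b <- enum 'I_k] w]]| =
   \sum_(w in multiset_words m n) F w.
  rewrite -sum1dep_card big_mkcond [RHS]big_mkcond; apply: eq_bigr => w _.
  case: (w \in multiset_words m n) => //=; rewrite /F.
  case: forallP => [H|/forallP].
    by rewrite big1 // => a _; rewrite H.
  by rewrite negb_forall => /existsP[a /negbTE sa]; rewrite (bigD1 a) //= sa.
have -> : k`! ^ #|A| = #|{ffun A -> {perm 'I_k}}|.
  by rewrite card_ffun; congr (_ ^ _); rewrite -card_Sn.
rewrite mulnC -sum_nat_const.
under eq_bigr => s _ do rewrite -(sum_relabel (shuffle s)^-1%g).
rewrite exchange_big /=; apply: eq_bigr => w _.
rewrite /F /=.
under eq_bigr => s _.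
  under eq_bigr => a _.
    rewrite subseq_map_perm -map_comp (eq_map (shuffleE s a)).
    over.
  over.
rewrite -(bigA_distr_bigA (fun a (s : {perm 'I_k}) =>
  (~~ subseq [seq f a (s b) | b <- enum 'I_k] w : nat))).
apply: eq_bigr => a _.
have <- : #|{perm 'I_k}| = k`! by rewrite -card_Sn.
rewrite -(cardsC (orderings w (f a))) addKn -sum1_card [RHS]big_mkcond /=.
by apply: eq_bigr => s _; rewrite !inE; case: subseq.
Qed.
End Blocks.

(** * Coincidences inside a window *)

Lemma card_occurrences m n (w : (m * n).-tuple 'I_n) x : w \in multiset_words m n ->
  #|[set p | tnth w p == x]| = m.
Proof.
move=> wW; apply: etrans (count_multiset_words x wW).
rewrite -[in RHS](map_tnth_enum w) count_map cardsE cardE size_filter enumT.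
exact: eq_count.
Qed.

Definition coincidences (m n : nat) (p q : 'I_(m * n)) : {set (m * n).-tuple 'I_n} :=
  [set w in multiset_words m n | tnth w p == tnth w q].

(** Swapping the positions [q] and [q'] maps words to words. *)
Lemma card_coincidences_tperm m n (p q q' : 'I_(m * n)) : q != p -> q' != p ->
  #|coincidences p q| <= #|coincidences p q'|.
Proof.
move=> qp q'p; pose F (w : (m * n).-tuple 'I_n) := [tuple tnth w (tperm q q' i) | i < m * n].
have FK : involutive F.
  by move=> w; apply: eq_from_tnth => i; rewrite !tnth_mktuple tpermK.
rewrite -(card_imset _ (inv_inj FK)); apply/subset_leq_card/subsetP => v /imsetP[w].
rewrite inE => /andP[wW wpq] ->; rewrite inE; apply/andP; split.
  rewrite inE; apply/forallP => x; apply/eqP; apply: etrans (count_multiset_words x wW).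
  by apply/seq.permP; apply/tuple_permP; exists (tperm q q').
by rewrite !tnth_mktuple tpermR tpermD // eq_sym.
Qed.

(** The letter at [p] has [m.-1] other copies. *)
Lemma sum_coincidences m n (p : 'I_(m * n)) :
  \sum_(q | q != p) #|coincidences p q| = m.-1 * #|multiset_words m n|.
Proof.
transitivity (\sum_(q | q != p) \sum_(w in multiset_words m n) (tnth w p == tnth w q)).
  apply: eq_bigr => q _; rewrite -sum1dep_card big_mkcondr /=.
  by apply: eq_bigr => w _; case: eqP.
rewrite exchange_big [RHS]mulnC -sum_nat_const /=; apply: eq_bigr => w wW.
rewrite -[m in RHS](card_occurrences (tnth w p) wW) (cardsD1 p) inE eqxx add1n /=.
rewrite -sum1_card big_mkcond [RHS]big_mkcond; apply: eq_bigr => q _.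
by rewrite !inE [tnth w p == _]eq_sym; case: (q == p) => /=; case: (tnth w q == tnth w p).
Qed.

(** By symmetry two given positions carry the same letter with probability
    [(m - 1) / (m * n - 1)], which is at most [m / (m * n)]. *)
Lemma card_coincidences m n (p q : 'I_(m * n)) : p != q ->
  #|coincidences p q| * (m * n) <= m * #|multiset_words m n|.
Proof.
move=> pq; have qp : q != p by rewrite eq_sym.
have L_gt0 : 0 < m * n by case: (m * n) p {q pq qp} => // -[].
have m_gt0 : 0 < m by case: (m) L_gt0.
have eL x : x * (m * n) = x + x * (m * n).-1 by rewrite -mulnS prednK.
have em x : m * x = x + m.-1 * x by rewrite -mulSn prednK.
rewrite eL [X in _ <= X]em leq_add //.
  by apply/subset_leq_card/subsetP => w; rewrite inE => /andP[].
rewrite -(sum_coincidences p).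
apply: (@leq_trans (\sum_(q' | q' != p) #|coincidences p q|)).
  by rewrite sum_nat_const mulnC leq_mul2r cardC1 card_ord leqnn orbT.
by apply: leq_sum => q' q'p; apply: card_coincidences_tperm.
Qed.

Section Window.
Variables (m n M l : nat).
Hypothesis l_gt0 : 0 < l.
Hypothesis Ml : m * n <= M.+1 * l.

Definition window (p : 'I_(m * n)) : 'I_M.+1 := inord (p %/ l).

Lemma windowE p : window p = p %/ l :> nat.
Proof. by rewrite inordK // ltn_divLR // (leq_trans (ltn_ord p)). Qed.

Lemma window_mono (p p' : 'I_(m * n)) : p <= p' -> window p <= window p'.
Proof. by move=> le_p; rewrite !windowE leq_div2r. Qed.

Lemma card_same_window p : #|[set q | window p == window q]| <= l.
Proof.
pose F (q : 'I_(m * n)) := Ordinal (ltn_pmod q l_gt0).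
rewrite -[X in _ <= X](card_ord l) -(@card_in_imset _ _ F) ?max_card // => q q'.
rewrite !inE => /eqP -> /eqP/(congr1 val); rewrite /= !windowE => eq_d [eq_m].
by apply: val_inj; rewrite /= (divn_eq q l) (divn_eq q' l) eq_d eq_m.
Qed.

(** The letters having two copies in a common window. *)
Definition crowded (w : (m * n).-tuple 'I_n) : {set 'I_n} :=
  [set x | #|pieces_of w window x| < m].

(** A crowded letter yields two distinct positions of the same window carrying that
    letter; there are at most [m * n * l] such pairs of positions. *)
Lemma sum_crowded : 
  \sum_(w in multiset_words m n) #|crowded w| <= l * m * #|multiset_words m n|.
Proof.
have [L_eq0|L_gt0] := posnP (m * n).
  rewrite big1 // => w _; apply: eq_card0 => x; rewrite inE; apply/negbTE.
  move/eqP: L_eq0; rewrite muln_eq0 -leqNgt => /orP[/eqP m0|/eqP n0].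
    by rewrite [X in X <= _]m0.
  by exfalso; have := ltn_ord x; rewrite [X in _ < X]n0.
rewrite -(leq_pmul2l L_gt0).
pose P (pq : 'I_(m * n) * 'I_(m * n)) := (pq.1 != pq.2) && (window pq.1 == window pq.2).
apply: (@leq_trans (m * n * \sum_(pq | P pq) #|coincidences pq.1 pq.2|)).
  rewrite leq_mul2l; apply/orP; right.
  have -> : \sum_(pq | P pq) #|coincidences pq.1 pq.2| =
     \sum_(w in multiset_words m n) #|[set pq | P pq & tnth w pq.1 == tnth w pq.2]|.
    under [RHS]eq_bigr => w _ do rewrite -sum1dep_card big_mkcondr.
    rewrite exchange_big /=; apply: eq_bigr => pq _.
    by rewrite -sum1dep_card big_mkcondr.
  apply: leq_sum => w wW; apply: leq_trans (leq_imset_card (fun pq => tnth w pq.1) _).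
  apply/subset_leq_card/subsetP => x; rewrite inE => few.
  have cardO := card_occurrences x wW.
  have [/dinjectiveP inj|] := boolP (dinjectiveb window [set p | tnth w p == x]).
    by move: few; rewrite /pieces_of card_in_imset // cardO ltnn.
  case/dinjectivePn => p; rewrite inE => /eqP wp [q]; rewrite !inE => /andP[qp wq] cpq.
  apply/imsetP; exists (p, q) => //=; rewrite inE /P /= eq_sym qp cpq eqxx /=.
  by rewrite wp eq_sym.
rewrite big_distrr /=.
apply: (@leq_trans (\sum_(pq | P pq) m * #|multiset_words m n|)).
  by apply: leq_sum => pq /andP[npq _]; rewrite mulnC card_coincidences.
have cardP : \sum_(pq | P pq) 1 <= m * n * l.
  rewrite -(pair_big_dep xpredT (fun p q => (p != q) && (window p == window q)) (fun _ _ => 1)) /=.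
  rewrite -[X in X * l]card_ord -sum_nat_const; apply: leq_sum => p _.
  apply: leq_trans (card_same_window p); rewrite sum1dep_card.
  by apply/subset_leq_card/subsetP => q; rewrite !inE => /andP[].
rewrite sum_nat_const -sum1_card; apply: leq_trans (leq_mul cardP (leqnn _)) _.
by rewrite !mulnA.
Qed.
End Window.

(** * First moment and avoidance bounds *)

Lemma card_orderings_fact n L k (w : L.-tuple 'I_n) (t : 'I_k -> 'I_n) :
  #|orderings w t| <= k`!.
Proof. by have <- : #|{perm 'I_k}| = k`!; [rewrite -card_Sn | apply: max_card]. Qed.

Lemma card_orderings_multiset m n k (w : (m * n).-tuple 'I_n) (t : 'I_k -> 'I_n) :
  injective t -> w \in multiset_words m n -> #|orderings w t| <= m ^ k.
Proof.
move=> inj_t wW; apply: leq_trans (card_orderings_le _ inj_t) _.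
rewrite card_placements -[X in m ^ X]card_ord -prod_nat_const.
by apply: leq_prod => b _; rewrite count_multiset_words.
Qed.

(** The averaging identity for a single block. *)
Lemma card_contains m n k (t : 'I_k -> 'I_n) : injective t ->
  #|[set w in multiset_words m n | subseq [seq t b | b <- enum 'I_k] w]| * k`!
    <= m ^ k * #|multiset_words m n|.
Proof.
move=> inj_t; set W := multiset_words m n; set S := [set w in W | _].
have inj_f : injective (fun ab : unit * 'I_k => t ab.2).
  by move=> [[] b] [[] b'] /= /inj_t ->.
have := @card_avoid unit n k (fun _ => t) inj_f m; rewrite -/W card_unit expn1.
under eq_bigr => w _ do rewrite big_const card_unit /= muln1.
have -> : [set w in W | [forall a : unit, ~~ subseq [seq t b | b <- enum 'I_k] w]] = W :\: S.
  apply/setP => w; rewrite !inE; case: [forall i, count_mem i w == m] => //=.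
  by rewrite andbT; apply/forallP/idP => [/(_ tt)|H []].
move=> avoidE.
have sumE : \sum_(w in W) (k`! - #|orderings w t|) + \sum_(w in W) #|orderings w t| = #|W| * k`!.
  rewrite -big_split /= -sum_nat_const; apply: eq_bigr => w _.
  by rewrite subnK // card_orderings_fact.
have cardE : #|W :\: S| + #|S| = #|W|.
  rewrite -(cardsID S W) addnC; congr (#|pred_of_set _| + _).
  by apply/esym/setIidPr/subsetP => w; rewrite inE => /andP[].
have -> : #|S| * k`! = \sum_(w in W) #|orderings w t|.
  by apply: (@addnI (#|W :\: S| * k`!)); rewrite -mulnDl cardE -sumE -avoidE.
rewrite [X in _ <= X]mulnC -sum_nat_const; apply: leq_sum => w.
exact: card_orderings_multiset.
Qed.

(** A letter that is not crowded meets [m] windows, any other letter at least one. *)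
Lemma orderings_ge m n k M l (w : (m * n).-tuple 'I_n) (t : 'I_k -> 'I_n) :
  0 < m -> 0 < l -> m * n <= M.+1 * l -> injective t -> w \in multiset_words m n ->
  m ^ #|[set b | t b \notin crowded M l w]| <= #|orderings w t| * (k + M) ^ M.
Proof.
move=> m_gt0 l_gt0 Ml inj_t wW.
apply: (@leq_trans (\prod_(b < k) #|pieces_of w (@window m n M l) (t b)|)).
  rewrite -prod_nat_const big_mkcond /=; apply: leq_prod => b _.
  rewrite !inE -leqNgt; case: ifP => // _.
  have /card_gt0P[p] : 0 < #|[set p | tnth w p == t b]| by rewrite (card_occurrences _ wW).
  by move=> Op; apply/card_gt0P; exists (@window m n M l p); apply: imset_f.
apply: leq_trans (prod_pieces_le w inj_t (window_mono l_gt0 Ml)) _.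
by rewrite leq_mul2l card_nondecreasing_maps_le orbT.
Qed.

(** The inequality [(1 - z) ^ T <= 1 / (1 + T * z)] at [z = y / K], without
    denominators. *)
Lemma bernoulli_nat K y T : y <= K -> (K - y) ^ T * (K + T * y) <= K ^ T * K.
Proof.
move=> yK; elim: T => [|T IH]; first by rewrite !expn0 mul0n addn0.
rewrite !expnS -!mulnA.
apply: (@leq_trans (K * ((K - y) ^ T * (K + T * y)))); last by rewrite leq_mul2l IH orbT.
rewrite mulnCA [X in _ <= X]mulnCA leq_mul2l; apply/orP; right.
rewrite mulnBl leq_subLR mulSn; nia.
Qed.

(** If at least [T] blocks have at least [y] orderings, then the conditional
    probability of avoidance is at most [(1 - y / k!) ^ T]; the first term on the
    right accounts for the words without [T] such blocks. *)
Lemma card_avoid_le (A : finType) n k (f : A -> 'I_k -> 'I_n) m y T :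
  injective (fun ab => f ab.1 ab.2) ->
  #|[set w in multiset_words m n |
     [forall a, ~~ subseq [seq f a b | b <- enum 'I_k] w]]| * (k`! + T * y)
  <= #|[set w in multiset_words m n |
         #|[set a | y <= #|orderings w (f a)|]| < T]| * (k`! + T * y)
     + #|multiset_words m n| * k`!.
Proof.
move=> inj_f; set W := multiset_words m n.
set Av := [set w in W | _]; set X := [set w in W | _].
have K_gt0 : 0 < k`! ^ #|A| by rewrite expn_gt0 fact_gt0.
rewrite -(leq_pmul2r K_gt0) mulnAC card_avoid // mulnDl big_distrl /=.
have -> : #|X| = \sum_(w in W) (w \in X).
  rewrite -sum1_card big_mkcond [RHS]big_mkcond; apply: eq_bigr => w _.
  by rewrite in_set -/W; case: (w \in W) => //=; case: (_ < _).
rewrite -mulnA -sum_nat_const big_distrl big_distrl -big_split /=; apply: leq_sum => w wW.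
have prod_le (S : {set A}) : \prod_a (k`! - #|orderings w (f a)|) <= 
    (\prod_(a in S) (k`! - #|orderings w (f a)|)) * k`! ^ (#|A| - #|S|).
  rewrite (bigID (mem S)) /= leq_mul2l; apply/orP; right.
  have -> : #|A| - #|S| = #|~: S| by rewrite -(cardsC S) addKn.
  rewrite -prod_nat_const [X in _ <= X](eq_bigl (fun a => a \notin S)); last first.
    by move=> a; rewrite in_setC.
  by apply: leq_prod => a _; apply: leq_subr.
case: (boolP (w \in X)) => [_|].
  rewrite mul1n mulnC; apply: leq_trans (leq_addr _ _); rewrite leq_mul2l; apply/orP; right.
  by apply: leq_trans (prod_le set0) _; rewrite big_set0 cards0 subn0 mul1n.
rewrite in_set wW /= -leqNgt mul0n add0n; set S := [set a | _] => leTS.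
have T_A : T <= #|A| by rewrite (leq_trans leTS) ?max_card.
have [T0|T_gt0] := posnP T.
  rewrite T0 mul0n addn0 mulnC leq_mul2l.
  by have := prod_le set0; rewrite big_set0 cards0 subn0 mul1n => ->; rewrite orbT.
have yK : y <= k`!.
  have /card_gt0P[a0] := leq_trans T_gt0 leTS.
  by rewrite inE => y_le; apply: leq_trans y_le (card_orderings_fact _ _).
have -> : k`! * k`! ^ #|A| = k`! ^ T * k`! * k`! ^ (#|A| - T).
  by rewrite mulnAC -expnD subnKC // mulnC.
apply: leq_trans (leq_mul (bernoulli_nat T yK) (leqnn _)).
rewrite mulnAC leq_mul2r; apply/orP; right.
apply: leq_trans (prod_le S) _.
apply: (@leq_trans ((k`! - y) ^ #|S| * k`! ^ (#|A| - #|S|))).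
  rewrite leq_mul2r -prod_nat_const; apply/orP; right.
  by apply: leq_prod => a; rewrite inE => y_le; apply: leq_sub2l.
rewrite -{1}(subnKC leTS) expnD -mulnA leq_mul2l; apply/orP; right.
have -> : #|A| - T = (#|S| - T) + (#|A| - #|S|).
  by have S_A : #|S| <= #|A| := max_card _; lia.
rewrite expnD leq_mul2r; apply/orP; right.
by case: (#|S| - T) => // r; rewrite leq_exp2r // leq_subr.
Qed.

(** * Longest runs *)

Lemma card_multiset_words_gt0 m n : 0 < #|multiset_words m n|.
Proof.
have size_s : size (flatten [seq nseq m x | x <- enum 'I_n]) == m * n.
  rewrite size_flatten /shape -map_comp (eq_map (g := fun _ => m)) => [|x /=].
    by rewrite sumnE big_map big_enum sum_nat_const card_ord mulnC.
  by rewrite size_nseq.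
apply/card_gt0P; exists (Tuple size_s); rewrite inE; apply/forallP => x /=.
rewrite count_flatten -map_comp sumnE big_map big_enum (bigD1 x) //= count_nseq /=.
rewrite eqxx mul1n big1 ?addn0 // => y yx.
by rewrite /= count_nseq /= (negbTE yx).
Qed.

Lemma subseq_iota n (w : seq 'I_n) i k (f : 'I_k -> 'I_n) :
  (forall b, f b = i + b :> nat) ->
  subseq (iota i k) (map val w) = subseq [seq f b | b <- enum 'I_k] w.
Proof.
move=> fE; have -> : iota i k = map val [seq f b | b <- enum 'I_k].
  rewrite -map_comp (eq_map (g := fun b : 'I_k => i + val b)) => [|b]; last exact: fE.
  by rewrite (map_comp (addn i) val) val_enum_ord -iotaDl addn0.
apply/idP/idP => [/subseqP[u]|]; last exact: map_subseq.
rewrite size_map => sz_u; rewrite -map_mask => /(inj_map val_inj) ->.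
exact: mask_subseq.
Qed.

Lemma longest_run_ge n (w : seq 'I_n) i k :
  i + k <= n -> subseq (iota i k) (map val w) -> k <= longest_run w.
Proof.
case: k => // k ik sub_w; have lt_i : i < n by lia.
have lt_j : i + k < n by lia.
rewrite /longest_run.
apply: leq_trans (@leq_bigmax _ _ (Ordinal lt_i)).
have jE : (i + k).+1 - i = k.+1 by lia.
apply: leq_trans (@leq_bigmax_cond _ _ _ (Ordinal lt_j) _).
  by rewrite /= size_iota jE.
by rewrite /= leq_addr /index_iota jE.
Qed.

(** A run of length [l] contains runs of all the lengths [K.+1, ..., l], so the
    excess of the longest run over [K] is at most the number of longer runs. *)
Lemma longest_run_le n (w : seq 'I_n) K :
  longest_run w <= K + \sum_(K.+1 <= k < n.+1) \sum_(i < n | i + k <= n)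
      subseq (iota i k) (map val w).
Proof.
apply/bigmax_leqP => i _; apply/bigmax_leqP => j /andP[ij].
rewrite size_iota /index_iota; set l := j.+1 - i => sub_w.
have [lK|Kl] := leqP l K; first exact: leq_trans lK (leq_addr _ _).
have ln : l <= n by rewrite /l; have := ltn_ord j; lia.
rewrite -leq_subLR (@big_cat_nat _ _ _ l.+1 K.+1 n.+1) //=; last by rewrite ltnS ltnW.
apply: leq_trans _ (leq_addr _ _).
apply: (@leq_trans (\sum_(K.+1 <= k < l.+1) 1)); first by rewrite sum_nat_const_nat; lia.
rewrite big_nat [X in _ <= X]big_nat; apply: leq_sum => k /andP[_ kl].
rewrite (bigD1 i) /=; last by rewrite /l in kl; have := ltn_ord j; lia.
have -> : subseq (iota i k) [seq val i | i <- w].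
  apply: subseq_trans sub_w; rewrite -(subnKC (_ : k <= l)) // iotaD.
  exact: prefix_subseq.
by [].
Qed.

Definition run_occurrences m n k :=
  \sum_(i < n | i + k <= n)
    #|[set w in multiset_words m n | subseq (iota i k) (map val w)]|.

Lemma run_occurrences_le m n k :
  run_occurrences m n k * k`! <= n * m ^ k * #|multiset_words m n|.
Proof.
rewrite /run_occurrences big_distrl /= -mulnA.
apply: (@leq_trans (\sum_(i < n) m ^ k * #|multiset_words m n|)); last first.
  by rewrite sum_nat_const card_ord.
rewrite big_mkcond; apply: leq_sum => i _; case: ifP => // ik.
have fP (b : 'I_k) : i + b < n by apply: leq_trans ik; rewrite ltn_add2l.
pose f (b : 'I_k) : 'I_n := Ordinal (fP b).
have f_inj : injective f by move=> b b' /(congr1 val) /= /addnI/val_inj.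
apply: leq_trans (card_contains m f_inj).
rewrite leq_mul2r; apply/orP; right; apply/subset_leq_card/subsetP => w.
by rewrite !in_set (@subseq_iota _ _ _ _ f).
Qed.

Lemma sum_longest_run_le m n K :
  \sum_(w in multiset_words m n) longest_run w
    <= K * #|multiset_words m n|
       + \sum_(K.+1 <= k < n.+1) run_occurrences m n k.
Proof.
have -> : \sum_(K.+1 <= k < n.+1) run_occurrences m n k =
    \sum_(w in multiset_words m n) \sum_(K.+1 <= k < n.+1)
      \sum_(i < n | i + k <= n) subseq (iota i k) (map val w).
  rewrite [RHS]exchange_big; apply: eq_bigr => k _ /=.
  rewrite [RHS]exchange_big; apply: eq_bigr => i _ /=.
  rewrite -sum1dep_card big_mkcondr /=.
  by apply: eq_bigr => w _; case: subseq.
rewrite [X in X + _]mulnC -sum_nat_const -big_split /=.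
by apply: leq_sum => w _; apply: longest_run_le.
Qed.

(** * Disjoint blocks of consecutive letters *)

Section DisjointBlocks.
Variables (n N k : nat) (Nk_le : N * k <= n).

Lemma block_letter_subproof (a : 'I_N) (b : 'I_k) : a * k + b < n.
Proof.
apply: leq_trans Nk_le; apply: (@leq_trans (a.+1 * k)).
  by rewrite mulSn addnC ltn_add2r.
by rewrite leq_mul2r ltn_ord orbT.
Qed.

Definition block_letter a b : 'I_n := Ordinal (block_letter_subproof a b).

Lemma block_letter_inj : injective (fun ab => block_letter ab.1 ab.2).
Proof.
move=> [a b] [a' b'] /(congr1 val) /= eq_ab.
have k_gt0 : 0 < k by apply: leq_ltn_trans (ltn_ord b).
have eq_a : a = a' :> nat.
  have := congr1 (fun x => x %/ k) eq_ab.
  by rewrite /= !divnMDl // !divn_small // !addn0.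
by move: eq_ab; rewrite eq_a => /addnI/val_inj ->; congr pair; apply: val_inj.
Qed.

Definition avoiding m : {set (m * n).-tuple 'I_n} :=
  [set w in multiset_words m n |
     [forall a, ~~ subseq [seq block_letter a b | b <- enum 'I_k] w]].

Lemma sum_longest_run_ge m :
  k * #|multiset_words m n| <= 
  \sum_(w in multiset_words m n) longest_run w + k * #|avoiding m|.
Proof.
have cardE : #|multiset_words m n :\: avoiding m| + #|avoiding m| = #|multiset_words m n|.
  rewrite -(cardsID (avoiding m) (multiset_words m n)) addnC; congr (#|pred_of_set _| + _).
  by apply/esym/setIidPr/subsetP => w; rewrite inE => /andP[].
rewrite -cardE mulnDr leq_add2r mulnC -sum_nat_const [X in _ <= X](bigID (mem (avoiding m))) /=.
apply: leq_trans (leq_addl _ _).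
rewrite big_mkcond [X in _ <= X]big_mkcond; apply: leq_sum => w _.
rewrite in_setD; case: (boolP (w \in avoiding m)) => [_|] /=; first by rewrite !andbF.
rewrite andbT; case: ifP => // wW; rewrite inE wW /= negb_forall => /existsP[a].
rewrite negbK -(@subseq_iota _ _ (a * k)) //; apply: longest_run_ge.
apply: leq_trans Nk_le; rewrite -{2}[k]mul1n -mulnDl leq_mul2r addn1.
by rewrite ltn_ord orbT.
Qed.

Lemma block_letter_inj2 a : injective (block_letter a).
Proof. by move=> b b' eq_b; have [] := @block_letter_inj (a, b) (a, b') eq_b. Qed.

(** If few letters are crowded, then at most half of the blocks consist of crowded
    letters by more than a half; each other block has at least [k./2] letters that
    contribute a factor [m] to its number of orderings. *)
Lemma many_good_blocks m M l (w : (m * n).-tuple 'I_n) : 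
  0 < k -> 0 < m -> 0 < l -> m * n <= M.+1 * l -> w \in multiset_words m n ->
  4 * #|crowded M l w| <= N * k ->
  N./2 <= #|[set a | m ^ k./2 %/ (k + M) ^ M <= #|orderings w (block_letter a)|]|.
Proof.
move=> k_gt0 m_gt0 l_gt0 Ml wW few.
pose bad a := #|[set b | block_letter a b \in crowded M l w]|.
have sum_bad : \sum_a bad a <= #|crowded M l w|.
  have -> : \sum_a bad a =
      #|[set ab : 'I_N * 'I_k | block_letter ab.1 ab.2 \in crowded M l w]|.
    rewrite -sum1dep_card -(pair_big_dep xpredT (fun a b => block_letter a b \in crowded M l w)
      (fun _ _ => 1)).
    by apply: eq_bigr => a _; rewrite sum1dep_card.
  rewrite -(card_imset _ block_letter_inj); apply/subset_leq_card/subsetP => x.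
  by case/imsetP => ab; rewrite inE => ab_crowded ->.
pose T := #|[set a | k < 2 * bad a]|.
have T_le : T * k <= 2 * \sum_a bad a.
  rewrite /T big_distrr -sum_nat_const big_mkcond; apply: leq_sum => a _.
  by rewrite inE; case: ifP => // /ltnW.
have T2 : 2 * T <= N by nia.
have card_good : #|[set a | 2 * bad a <= k]| = N - T.
  rewrite /T -[X in _ = X - _](card_ord N) -(cardsC [set a | k < 2 * bad a]) addKn.
  by apply: eq_card => a; rewrite !inE -leqNgt.
apply: (@leq_trans #|[set a | 2 * bad a <= k]|); first by rewrite card_good; lia.
apply/subset_leq_card/subsetP => a; rewrite !inE => few_a.
have B_gt0 : 0 < (k + M) ^ M by rewrite expn_gt0 addn_gt0 k_gt0.
rewrite -(leq_pmul2r B_gt0); apply: leq_trans (leq_trunc_div _ _) _.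
apply: leq_trans (orderings_ge m_gt0 l_gt0 Ml (@block_letter_inj2 a) wW).
rewrite leq_pexp2l //.
have := cardsC [set b | block_letter a b \in crowded M l w]; rewrite card_ord -/(bad a).
have -> : ~: [set b | block_letter a b \in crowded M l w] =
    [set b | block_letter a b \notin crowded M l w].
  by apply/setP => b; rewrite !inE.
by lia.
Qed.

(** The words to which [many_good_blocks] does not apply. *)
Definition overcrowded m M l : {set (m * n).-tuple 'I_n} :=
  [set w in multiset_words m n | N * k < 4 * #|crowded M l w|].

(** Markov's inequality for the number of crowded letters. *)
Lemma card_overcrowded m M l : 0 < l -> m * n <= M.+1 * l ->
  #|overcrowded m M l| * (N * k) <= 4 * (l * m) * #|multiset_words m n|.
Proof.
move=> l_gt0 Ml; rewrite -[X in _ <= X]mulnA.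
apply: (@leq_trans (4 * \sum_(w in multiset_words m n) #|crowded M l w|)).
  rewrite -sum_nat_const big_mkcond [X in _ <= _ * X]big_mkcond big_distrr /=.
  apply: leq_sum => w _; rewrite in_set.
  by case: (w \in multiset_words m n) => //=; case: ltnP => // /ltnW.
by rewrite leq_mul2l; apply: sum_crowded.
Qed.

Lemma card_avoiding_le m M l : 0 < k -> 0 < m -> 0 < l -> m * n <= M.+1 * l ->
  forall K, K = k`! + N./2 * (m ^ k./2 %/ (k + M) ^ M) ->
  #|avoiding m| * K
    <= #|overcrowded m M l| * K + #|multiset_words m n| * k`!.
Proof.
move=> k_gt0 m_gt0 l_gt0 Ml _ ->.
apply: leq_trans (card_avoid_le _ _ _ block_letter_inj) _.
rewrite leq_add2r leq_mul2r; apply/orP; right; apply/subset_leq_card/subsetP => w.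
rewrite inE => /andP[wW few]; rewrite inE wW /=; move: few; rewrite !ltnNge.
by apply: contra; apply: many_good_blocks.
Qed.

(** For permutations each block has exactly one ordering. *)
Lemma card_avoiding1_le : #|avoiding 1| * (k`! + N) <= #|multiset_words 1 n| * k`!.
Proof.
have := card_avoid_le 1 1 N block_letter_inj; rewrite muln1.
set X := [set w in _ | _ < _]; suff -> : X = set0 by rewrite cards0 mul0n add0n.
apply/setP => w; rewrite in_set0 /X; apply/negbTE; rewrite in_set; apply/negP => /andP[wW].
rewrite ltnNge => /negP[]; rewrite -[X in X <= _](card_ord N) -cardsT.
apply/subset_leq_card/subsetP => a _; rewrite inE.
have := @orderings_ge 1 n k 0 (1 * n).+1 w (block_letter a).
rewrite exp1n expn0 muln1; apply=> //; last exact: block_letter_inj2.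
by rewrite !mul1n leqnSn.
Qed.
End DisjointBlocks.

From mathcomp Require Import all_classical all_reals all_analysis.
From mathcomp Require Import measurable_realfun.
From mathcomp Require Import ring lra.
Import Order.TTheory GRing.Theory Num.Theory.
Import numFieldNormedType.Exports.

(** * Convexity of Gamma and its inverse *)

Local Open Scope classical_set_scope.
Local Open Scope ring_scope.

Section Gamma.
Variable R : realType.
Local Notation mu := (@lebesgue_measure R).

(** An antiderivative of [t ^+ k * expR (- t)] that vanishes at infinity, given by
    the recursion of integration by parts. *)
Fixpoint Gamma_prim (k : nat) (t : R) : R :=
  if k is k'.+1 then k%:R * Gamma_prim k' t - t ^+ k * expR (- t) else - expR (- t).

Lemma is_derive_expRN (t : R) : is_derive t 1 (fun t => expR (- t)) (- expR (- t)).
Proof.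
have := @is_derive1_comp R expR -%R t _ _ (is_derive_expR (- t)) (is_deriveNid t 1).
by rewrite mulrN1.
Qed.

Lemma is_derive_Gamma_prim k (t : R) :
  is_derive t 1 (Gamma_prim k) (t ^+ k * expR (- t)).
Proof.
have dE := is_derive_expRN t.
elim: k => [|k IH].
  by have := is_deriveN dE; rewrite opprK expr0 mul1r.
have := is_deriveB (is_deriveZ k.+1%:R IH) (is_deriveM (is_deriveX k.+1 (is_derive_id t 1)) dE).
rewrite (_ : _ - _ = Gamma_prim k.+1); last first.
  by apply/funext => x; rewrite !fctE.
move=> H; apply: is_derive_eq.
rewrite /GRing.scale /= mulr1 !exprfctE !exprS; ring.
Qed.

Lemma Gamma_prim0 k : Gamma_prim k 0 = - k`!%:R.
Proof.
elim: k => [|k IH] /=; first by rewrite oppr0 expR0.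
by rewrite IH exprS !mul0r subr0 factS natrM mulrN.
Qed.

(** The exponential series dominates [t ^+ k.+1 / k.+1!]. *)
Lemma cvg_exprn_expRN k : (t : R) ^+ k * expR (- t) @[t --> +oo] --> (0 : R).
Proof.
apply/cvgrPdist_le => /= e e0; near=> t.
have t0 : 0 < t by near: t; apply: nbhs_pinfty_gt; rewrite num_real.
rewrite sub0r normrN ger0_norm ?mulr_ge0 ?exprn_ge0 ?expR_ge0 ?(ltW t0) //.
have f0 : 0 < k.+1`!%:R :> R by rewrite ltr0n fact_gt0.
have : t ^+ k.+1 / k.+1`!%:R <= expR t.
  by apply: le_trans (expR_ge1Dxn k (ltW t0)); rewrite lerDr.
rewrite ler_pdivrMr // expRN ler_pdivrMr ?expR_gt0 // exprSr => H.
have te : k.+1`!%:R / e <= t by near: t; apply: nbhs_pinfty_ge; rewrite num_real.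
rewrite ler_pdivrMr // in te.
rewrite -(ler_pM2r t0); apply: le_trans H _.
by rewrite [leRHS]mulrAC mulrC ler_pM2r ?expR_gt0 // [e * t]mulrC.
Unshelve. all: end_near. Qed.

Lemma Gamma_prim_cvgy k : Gamma_prim k t @[t --> +oo] --> (0 : R).
Proof.
elim: k => [|k IH] /=; first by rewrite -oppr0; apply: cvgN; exact: cvgr_expR.
rewrite -[X in _ --> X](subr0 0) -[X in _ --> X - _](mulr0 k.+1%:R).
by apply: cvgB (cvg_exprn_expRN k.+1); apply: cvgMr.
Qed.

Lemma integral_exprn_expRN k :
  (\int[mu]_(t in `]0%R, +oo[) (t ^+ k * expR (- t))%:E = (k`!%:R)%:E)%E.
Proof.
have cF (x : R) : {for x, continuous (Gamma_prim k)}.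
  apply: differentiable_continuous; apply/derivable1_diffP.
  by case: (is_derive_Gamma_prim k x).
have cf : continuous (fun t : R => t ^+ k * expR (- t)).
  move=> x; apply: cvgM; first exact: exprn_continuous.
  by apply: (@continuous_comp _ _ _ -%R expR); [exact: oppr_continuous|exact: continuous_expR].
rewrite integral_itv_obnd_cbnd; last first.
  apply/measurable_EFinP; apply: measurable_funTS; exact: continuous_measurable_fun.
rewrite (@ge0_continuous_FTC2y _ _ (Gamma_prim k) _ 0) //.
- by rewrite Gamma_prim0 sub0e -EFinN opprK.
- by move=> x x0; rewrite mulr_ge0 ?exprn_ge0 ?expR_ge0.
- by apply: continuous_subspaceT.
- exact: Gamma_prim_cvgy.
- by move=> x _; case: (is_derive_Gamma_prim k x).
- by apply: cvg_at_right_filter; apply: cF.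
- by move=> x _; rewrite derive1E; case: (is_derive_Gamma_prim k x).
Qed.

(** The graph lies above its tangent at the intermediate point. *)
Lemma expR_convex (l a b : R) : 0 <= l <= 1 ->
  expR (l * a + (1 - l) * b) <= l * expR a + (1 - l) * expR b.
Proof.
case/andP => l0 l1; set u := _ + _.
have tangent v : expR u * (1 + (v - u)) <= expR v.
  have -> : expR v = expR u * expR (v - u) by rewrite -expRD addrC subrK.
  by rewrite ler_pM2l ?expR_gt0 // expR_ge1Dx.
have l'0 : 0 <= 1 - l by rewrite subr_ge0.
apply: le_trans (lerD (ler_wpM2l l0 (tangent a)) (ler_wpM2l l'0 (tangent b))).
by rewrite le_eqVlt; apply/orP; left; apply/eqP; rewrite /u; ring.
Qed.

Definition Gamma_integrand (x t : R) : R := t `^ (x - 1) * expR (- t).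

Lemma integrable_exprn_expRN k :
  mu.-integrable `]0, +oo[ (EFin \o (fun t : R => t ^+ k * expR (- t))).
Proof.
apply/integrableP; split.
  apply/measurable_EFinP; apply: measurable_funTS; apply: continuous_measurable_fun.
  move=> x; apply: cvgM; first exact: exprn_continuous.
  by apply: (@continuous_comp _ _ _ -%R expR); [exact: oppr_continuous|exact: continuous_expR].
rewrite (_ : (\int[_]_(x in _) _)%E = (k`!%:R)%:E) ?ltry //.
rewrite -integral_exprn_expRN; apply: eq_integral => t; rewrite inE /= in_itv /= andbT => t0.
by rewrite ger0_norm // mulr_ge0 ?expR_ge0 ?exprn_ge0 ?(ltW t0).
Qed.

(** For [1 <= x] the power of [t] is at most [1 + t ^+ k] for any integer [k >= x]. *)
Lemma integrable_Gamma_integrand (x : R) : 1 <= x ->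
  mu.-integrable `]0, +oo[ (EFin \o Gamma_integrand x).
Proof.
move=> x1; have x0 : 0 <= x by apply: le_trans x1.
pose k := (Num.truncn x).+1.
have xk : x <= k%:R by apply/ltW/truncnS_gt.
have : mu.-integrable `]0, +oo[ ((EFin \o (fun t : R => (t ^+ 0 * expR (- t))%R)) \+
   (EFin \o (fun t : R => (t ^+ k * expR (- t))%R)))%E.
  by apply: integrableD => //; exact: integrable_exprn_expRN.
apply: le_integrable => //.
  apply/measurable_EFinP; apply: measurable_funTS; apply: measurable_funM.
    exact: measurable_powR.
  apply: continuous_measurable_fun => y.
  by apply: (@continuous_comp _ _ _ -%R expR); [exact: oppr_continuous|exact: continuous_expR].
move=> t /=; rewrite in_itv /= andbT => t0; rewrite lee_fin /Gamma_integrand.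
rewrite !ger0_norm ?addr_ge0 ?mulr_ge0 ?expR_ge0 ?exprn_ge0 ?powR_ge0 ?(ltW t0) //.
rewrite -mulrDl ler_pM2r ?expR_gt0 // expr0.
have [t1|t1] := leP t 1.
  apply: (@le_trans _ _ 1); last by rewrite lerDl exprn_ge0 ?(ltW t0).
  by rewrite -[leRHS](powRr0 t) ger_powR ?t0 // subr_ge0.
apply: (@le_trans _ _ (t ^+ k)); last by rewrite lerDr.
rewrite -powR_mulrn ?(ltW t0) // ler_powR ?(ltW t1) // ltW //.
by rewrite (lt_le_trans _ xk) // ltrBlDr ltrDl.
Qed.

Lemma Gamma_factorial k : Gamma (k.+1%:R : R) = k`!%:R.
Proof.
rewrite /Gamma /Rintegral -[RHS]/(fine (k`!%:R)%:E) -integral_exprn_expRN; congr fine.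
apply: eq_integral => t; rewrite inE /= in_itv /= andbT => t0.
by rewrite -natr1 addrK powR_mulrn ?(ltW t0).
Qed.

(** For every [t] the integrand is an exponential function of [x]. *)
Lemma Gamma_convex (l x y : R) : 0 <= l <= 1 -> 1 <= x -> 1 <= y ->
  Gamma (l * x + (1 - l) * y) <= l * Gamma x + (1 - l) * Gamma y.
Proof.
move=> /[dup] l01 /andP[l0 l1] x1 y1; rewrite /Gamma -!/(Gamma_integrand _ _).
have iZ (c z : R) : 1 <= z -> mu.-integrable `]0, +oo[ (EFin \o (fun t => c * Gamma_integrand z t)).
  move=> z1; apply: eq_integrable (integrableZl _ c (integrable_Gamma_integrand z1)) => //.
rewrite -!RintegralZl //; try exact: integrable_Gamma_integrand.
rewrite -RintegralD //; try exact: iZ.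
apply: le_Rintegral => //.
- apply: integrable_Gamma_integrand; nra.
- by apply: eq_integrable (integrableD _ (iZ l x x1) (iZ (1 - l) y y1)).
move=> t /=; rewrite in_itv /= andbT => t0.
rewrite !mulrA -mulrDl ler_pM2r ?expR_gt0 //.
have powE (z : R) : t `^ z = expR (z * ln t) by rewrite /powR gt_eqF.
rewrite !powE; have := expR_convex ((x - 1) * ln t) ((y - 1) * ln t) l01.
by apply: le_trans; rewrite ler_expR le_eqVlt; apply/orP; left; apply/eqP; ring.
Qed.
End Gamma.

Section GammaInv.
Variable R : realType.
Implicit Types x y z : R.

Lemma Gamma_ge0 x : 0 <= Gamma x.
Proof. by apply: Rintegral_ge0 => t _; rewrite mulr_ge0 ?powR_ge0 ?expR_ge0. Qed.

Lemma Gamma_chord x y z : 1 <= x -> x <= y -> y <= z -> x < z ->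
  (z - x) * Gamma y <= (z - y) * Gamma x + (y - x) * Gamma z.
Proof.
move=> x1 xy yz xz; have zx0 : 0 < z - x by rewrite subr_gt0.
have zx_neq0 : z - x != 0 by rewrite gt_eqF.
have l01 : 0 <= (z - y) / (z - x) <= 1.
  rewrite divr_ge0 ?subr_ge0 ?(ltW xz) //= ler_pdivrMr // mul1r; lra.
have z1 : 1 <= z by lra.
have := Gamma_convex l01 x1 z1.
have -> : (z - y) / (z - x) * x + (1 - (z - y) / (z - x)) * z = y by field.
rewrite -(ler_pM2l zx0) => /le_trans; apply.
by move: (Gamma x) (Gamma z) => u v; rewrite le_eqVlt; apply/orP; left; apply/eqP; field.
Qed.

Lemma Gamma_le_chord k (q : R) : 0 <= q <= 1 ->
  Gamma (k.+1%:R + q) <= (1 - q) * k`!%:R + q * k.+1`!%:R.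
Proof.
move=> /andP[q0 q1]; rewrite -!Gamma_factorial.
have := @Gamma_chord k.+1%:R (k.+1%:R + q) k.+2%:R.
have -> : k.+2%:R - k.+1%:R = 1 :> R by rewrite -natr1; ring.
have -> : k.+2%:R - (k.+1%:R + q) = 1 - q by rewrite -natr1; ring.
rewrite mul1r addrAC subrr add0r; apply; rewrite ?ler1n ?ltr_nat ?lerDl //.
by rewrite -[leRHS]natr1 lerD2l.
Qed.

(** A convex function that does not decrease from [k + 1] to [k + 2] stays above its
    value at [k + 2] from there on. *)
Lemma fact_le_Gamma k x : k.+2%:R <= x -> k.+1`!%:R <= Gamma x.
Proof.
move=> kx; have kx' : k.+1%:R < x by apply: lt_le_trans kx; rewrite ltr_nat.
have := @Gamma_chord k.+1%:R k.+2%:R x; rewrite !Gamma_factorial ler1n ler_nat => chord.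
have {chord} := chord isT (leqnSn _) kx kx'.
have f_le : k`!%:R <= k.+1`!%:R :> R by rewrite ler_nat factS leq_pmull.
have kE : k.+2%:R = k.+1%:R + 1 :> R by rewrite natr1.
rewrite kE in kx *; have := Gamma_ge0 x; nra.
Qed.

(** The slopes of a convex function on an interval are controlled by its values at
    distance at least one outside of that interval. *)
Lemma Gamma_lipschitz a b y z : 1 <= a -> a + 1 <= y -> y <= z -> z + 1 <= b ->
  `|Gamma z - Gamma y| <= (z - y) * (Gamma a + Gamma b).
Proof.
move=> a1 ay yz zb.
have [->|yz'] := eqVneq y z; first by rewrite !subrr normr0 mul0r.
have {}yz' : y < z by rewrite lt_neqAle yz'.
have y1 : 1 <= y by lra.
have [ay' zb' az yb] : [/\ a <= y, z <= b, a < z & y < b] by split; lra.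
have by1 : 1 <= b - y by lra.
have za1 : 1 <= z - a by lra.
have zy0 : 0 <= z - y by lra.
have up := Gamma_chord y1 yz zb' yb; have lo := Gamma_chord a1 ay' yz az.
have := Gamma_ge0 a; have := Gamma_ge0 b; have := Gamma_ge0 y; have := Gamma_ge0 z.
move: (Gamma a) (Gamma b) (Gamma y) (Gamma z) up lo => A B Y Z up lo Z0 Y0 B0 A0.
have slope (c D r : R) : 1 <= c -> 0 <= r -> c * D <= r -> D <= r.
  move=> c1 r0; have [D0 _|D0] := leP D 0; first exact: le_trans r0.
  by apply: le_trans; rewrite ler_peMl // ltW.
have zA : 0 <= (z - y) * A by rewrite mulr_ge0.
have zB : 0 <= (z - y) * B by rewrite mulr_ge0.
have zZ : 0 <= (z - y) * Z by rewrite mulr_ge0.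
have zY : 0 <= (z - y) * Y by rewrite mulr_ge0.
have Y_Z : Y - Z <= (z - y) * A.
  apply: slope za1 zA _; move: lo zZ; clear=> lo zZ; lra.
have Z_Y : Z - Y <= (z - y) * B.
  apply: slope by1 zB _; move: up zY; clear=> up zY; lra.
rewrite ler_norml; move: zA zB Y_Z Z_Y; clear=> zA zB Y_Z Z_Y; lra.
Qed.

Lemma Gamma_within_continuous a b : 1 <= a ->
  {within `[a + 1, b], continuous (@Gamma R)}.
Proof.
move=> a1; pose K := Gamma a + Gamma (b + 1) + 1.
have K0 : 0 < K by rewrite ltr_wpDl // addr_ge0 // Gamma_ge0.
have lip y z : y \in `[a + 1, b] -> z \in `[a + 1, b] -> y <= z ->
    `|Gamma z - Gamma y| <= (z - y) * K.
  rewrite !in_itv /= => /andP[ay _] /andP[_ zb] yz.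
  apply: le_trans (Gamma_lipschitz a1 ay yz (_ : z + 1 <= b + 1)) _.
    by rewrite lerD2r.
  by rewrite ler_wpM2l ?subr_ge0 // lerDl.
apply/subspace_continuousP => y /= yI; apply/cvgrPdist_le => /= e e0.
rewrite near_withinE; near=> z => zI; apply: (@le_trans _ _ (`|y - z| * K)).
  have [yz|/ltW zy] := leP y z.
    by rewrite distrC [`|y - z|]distrC [`|z - y|]ger0_norm ?subr_ge0 // lip.
  by rewrite [`|y - z|]ger0_norm ?subr_ge0 // lip.
rewrite -ler_pdivlMr //.
near: z; apply/nbhs_ballP; exists (e / K); first by rewrite /= divr_gt0.
by move=> z /= /ltW.
Unshelve. all: end_near. Qed.

(** Intermediate values between consecutive factorials. *)
Lemma Gamma_surj n : (0 < n)%N -> exists x, 1 <= x /\ Gamma x = n%:R.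
Proof.
move=> n_gt0.
have [k kn nk] : exists2 k, (k.+1`! <= n)%N & (n <= k.+2`!)%N.
  have ex : exists k, (n <= k.+2`!)%N.
    by exists n; apply: leq_trans (fact_geq n) (ltnW (ltn_fact n_gt0 _)).
  case: (ex_minnP ex) => -[|k] nk min_k; first by exists 0%N.
  by exists k.+1 => //; rewrite ltnW // ltnNge; apply/negP => /min_k; rewrite ltnn.
have k1 : 1 <= k.+1%:R :> R by rewrite ler1n.
have cont := @Gamma_within_continuous k.+1%:R k.+3%:R k1; rewrite natr1 in cont.
have [||x] := @IVT R (@Gamma R) k.+2%:R k.+3%:R n%:R _ cont.
- by rewrite ler_nat.
- by rewrite !Gamma_factorial ge_min le_max !ler_nat kn nk orbT.
rewrite in_itv /= => /andP[kx _] xn; exists x; split=> //.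
by apply: le_trans kx; rewrite ler1n.
Qed.

(** The integer part of the inverse is at least [2] because Gamma is at most [1] on
    the interval from [1] to [2]. *)
Lemma inv_Gamma_itv n : (1 < n)%N -> exists (k : nat) (q : R),
  [/\ inv_Gamma R n = k.+2%:R + q, 0 <= q < 1, (k.+1`! <= n)%N &
      n%:R <= (1 - q) * k.+1`!%:R + q * k.+2`!%:R].
Proof.
move=> n_gt1.
have [x1 xn] : 1 <= inv_Gamma R n /\ Gamma (inv_Gamma R n) = n%:R.
  have [x xP] := Gamma_surj (ltnW n_gt1).
  by rewrite /inv_Gamma; apply: (@xgetPex _ 1 [set x : R | 1 <= x /\ Gamma x = n%:R]); exists x.
set x := inv_Gamma R n in x1 xn *.
have x0 : 0 <= x by lra.
pose q := x - (Num.truncn x)%:R.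
have xE : x = (Num.truncn x)%:R + q by rewrite /q; ring.
have q01 : 0 <= q < 1.
  have := truncn_itv x0; rewrite -natr1 /q; lra.
have q01' : 0 <= q <= 1 by lra.
have : (0 < Num.truncn x)%N by rewrite truncn_gt0.
case: (Num.truncn x) xE => [//|[|k]] xE _.
  have := Gamma_le_chord 0 q01'; rewrite -xE xn factS fact0 muln1.
  have : 2 <= n%:R :> R by rewrite ler_nat.
  by lra.
exists k, q; split => //.
  by rewrite -(ler_nat R) -xn fact_le_Gamma // xE; lra.
by rewrite -xn xE Gamma_le_chord.
Qed.
End GammaInv.

Local Close Scope classical_set_scope.

(** * Bounds on the expectation *)
Section Expectation.
Variable R : realType.
Local Notation E := (expected_longest_run R).

Let W_gt0 m n : 0 < #|multiset_words m n|%:R :> R.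
Proof. by rewrite ltr0n card_multiset_words_gt0. Qed.

Lemma expectedE m n :
  E m n * #|multiset_words m n|%:R = (\sum_(w in multiset_words m n) longest_run w)%:R.
Proof. by rewrite natr_sum divfK // gt_eqF. Qed.

Lemma expected_le m n K :
  E m n <= K%:R + \sum_(K.+1 <= k < n.+1) n%:R * m%:R ^+ k / k`!%:R.
Proof.
rewrite -(ler_pM2r (W_gt0 m n)) expectedE mulrDl mulr_suml.
apply: le_trans (_ : (K * #|multiset_words m n|
    + \sum_(K.+1 <= k < n.+1) run_occurrences m n k)%:R <= _).
  by rewrite ler_nat sum_longest_run_le.
rewrite natrD natrM lerD2l natr_sum; apply: ler_sum => k _.
rewrite mulrAC ler_pdivlMr ?ltr0n ?fact_gt0 //.
by rewrite -natrX -!natrM ler_nat run_occurrences_le.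
Qed.

Lemma expected_ge m n N k (Nk_le : (N * k <= n)%N) :
  k%:R * (1 - #|avoiding Nk_le m|%:R / #|multiset_words m n|%:R) <= E m n.
Proof.
rewrite -(ler_pM2r (W_gt0 m n)) expectedE.
rewrite -mulrA mulrBl mul1r divfK ?gt_eqF // mulrBr lerBlDr -!natrM -natrD ler_nat.
exact: sum_longest_run_ge.
Qed.

Lemma avoiding1_ratio_le n N k (Nk_le : (N * k <= n)%N) :
  #|avoiding Nk_le 1|%:R / #|multiset_words 1 n|%:R <= k`!%:R / (k`! + N)%:R :> R.
Proof.
rewrite ler_pdivrMr // mulrAC ler_pdivlMr ?ltr0n ?addn_gt0 ?fact_gt0 //.
by rewrite -!natrM ler_nat [X in (_ <= X)%N]mulnC card_avoiding1_le.
Qed.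

Lemma avoiding_ratio_le m n N k M l (Nk_le : (N * k <= n)%N) :
  (0 < k)%N -> (0 < N)%N -> (0 < m)%N -> (0 < l)%N -> (m * n <= M.+1 * l)%N ->
  #|avoiding Nk_le m|%:R / #|multiset_words m n|%:R <=
    (4 * (l * m))%:R / (N * k)%:R
      + k`!%:R / (k`! + N./2 * (m ^ k./2 %/ (k + M) ^ M))%:R :> R.
Proof.
move=> k_gt0 N_gt0 m_gt0 l_gt0 Ml.
have x_le := card_overcrowded N k l_gt0 Ml.
have := card_avoiding_le Nk_le k_gt0 m_gt0 l_gt0 Ml erefl.
set x := #|overcrowded n N k m M l| in x_le *.
set K := (k`! + _)%N => avoid_le.
have K_gt0 : 0 < K%:R :> R by rewrite ltr0n addn_gt0 fact_gt0.
have Nk_gt0 : 0 < (N * k)%:R :> R by rewrite ltr0n muln_gt0 N_gt0.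
have W0 := W_gt0 m n.
apply: (@le_trans _ _ (x%:R / #|multiset_words m n|%:R + k`!%:R / K%:R)).
  rewrite -(ler_pM2r W0) -(ler_pM2r K_gt0) divfK ?gt_eqF //.
  rewrite mulrDl divfK ?gt_eqF // mulrDl [k`!%:R / _ * _]mulrAC divfK ?gt_eqF //.
  by rewrite -!natrM -natrD ler_nat [(k`! * _)%N]mulnC.
rewrite lerD2r ler_pdivrMr // mulrAC ler_pdivlMr // -!natrM ler_nat.
exact: x_le.
Qed.

(** From [K] on, every term is at most half of the preceding one. *)
Lemma factorial_tail_le (m K n : nat) : (2 * m <= K.+1)%N ->
  \sum_(K <= k < n) m%:R ^+ k / k`!%:R <= 2 * (m%:R ^+ K / K`!%:R) :> R.
Proof.
move=> mK; pose a k : R := m%:R ^+ k / k`!%:R.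
have a_ge0 k : 0 <= a k by rewrite divr_ge0 ?exprn_ge0.
have aS k : (K <= k)%N -> 2 * a k.+1 <= a k.
  move=> Kk; have -> : a k.+1 = a k * (m%:R / k.+1%:R).
    by rewrite /a exprSr factS mulnC natrM invfM mulrACA.
  rewrite mulrCA ler_piMr // mulrA ler_pdivrMr // mul1r -natrM ler_nat.
  by rewrite (leq_trans mK).
have [nK|Kn] := leqP n K; first by rewrite big_geq // mulr_ge0 // a_ge0.
suff H : \sum_(K <= k < n) a k <= 2 * a K - 2 * a n.
  by apply: le_trans H _; rewrite gerBl mulr_ge0.
rewrite -(subnKC (ltnW Kn)); elim: (n - K)%N => [|i IH].
  by rewrite addn0 big_geq // subrr.
rewrite addnS big_nat_recr ?leq_addr //=.
by have := aS (K + i)%N (leq_addr _ _); lra.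
Qed.
End Expectation.

(** * The case of permutations *)

Section Permutations.
Variable R : realType.
Local Notation E := (expected_longest_run R).

(** With [j = i + 2]: runs of length [j] contribute [n / j! <= q + (1 - q) / j], and
    longer runs contribute [O (1 / j)]. *)
Lemma expected1_le i n (q : R) : (4 <= i)%N ->
  0 <= q <= 1 -> n%:R <= (1 - q) * i.+1`!%:R + q * i.+2`!%:R ->
  E 1 n <= i%:R + 1 + q + 3 / i.+2%:R.
Proof.
move=> i4 /andP[q0 q1] n_le; apply: le_trans (expected_le R 1 n i.+1) _.
rewrite -natr1 -!addrA lerD2l lerD2l.
under eq_bigr => k _ do rewrite -mulrA.
rewrite -mulr_sumr.
have sum_le : \sum_(i.+2 <= k < n.+1) 1%:R ^+ k / k`!%:R
    <= i.+2`!%:R^-1 * (1 + 2 / i.+3%:R) :> R.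
  have tail := @factorial_tail_le R 1 i.+3 n.+1 isT.
  have fS : 1%:R ^+ i.+3 / i.+3`!%:R = i.+2`!%:R^-1 / i.+3%:R :> R.
    by rewrite expr1n mul1r factS natrM invfM mulrC.
  rewrite fS in tail; have [ni|ni] := leqP n.+1 i.+2.
    by rewrite big_geq // mulr_ge0 ?invr_ge0 // addr_ge0 // divr_ge0.
  rewrite big_ltn // expr1n mul1r mulrDr mulr1 lerD2l; apply: le_trans tail _.
  by rewrite mulrCA.
apply: le_trans (ler_wpM2l (ler0n _ _) sum_le) _.
have f0 : 0 < i.+1`!%:R :> R by rewrite ltr0n fact_gt0.
have i0 : 0 < i.+2%:R :> R by [].
rewrite mulrA; apply: (@le_trans _ _ (((1 - q) / i.+2%:R + q) * (1 + 2 / i.+3%:R))).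
  rewrite ler_wpM2r ?addr_ge0 ?divr_ge0 // ler_pdivrMr ?ltr0n ?fact_gt0 //.
  apply: le_trans n_le _; rewrite [in leRHS]factS natrM mulrDl.
  by rewrite le_eqVlt; apply/orP; left; apply/eqP; field; rewrite gt_eqF.
have c_le : i.+3%:R^-1 <= i.+2%:R^-1 :> R by rewrite lef_pV2 ?posrE // ler_nat.
have b1 : i.+2%:R^-1 <= 1 :> R by rewrite invf_le1 // ler1n.
have c0 : 0 <= i.+3%:R^-1 :> R by rewrite invr_ge0.
move: c_le b1 c0; set b := i.+2%:R^-1; set c := i.+3%:R^-1 => c_le b1 c0.
have : (1 - q) * b + q <= 1 by nra.
nra.
Qed.

(** Blocks of length [k = i - 1]: as [n >= (k + 2)!], there are so many of them that
    all fail with probability at most [1 / k]. *)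
Lemma expected1_ge i n : (0 < i)%N -> (i.+1`! <= n)%N -> i%:R - 2 <= E 1 n.
Proof.
case: i => [//|k] _ n_ge; have [->|k_gt0] := posnP k.
  apply: (@le_trans _ _ 0); first by lra.
  by rewrite divr_ge0 // sumr_ge0.
have Nk_le := leq_trunc_div n k.
have := expected_ge R 1 Nk_le; apply: le_trans.
have := @avoiding1_ratio_le R n (n %/ k) k Nk_le.
set r := _ / _; move=> r_le.
suff : k%:R * r <= 1 by rewrite mulrBr mulr1 -!natr1; lra.
apply: le_trans (ler_wpM2l (ler0n _ _) r_le) _.
rewrite mulrA ler_pdivrMr ?ltr0n ?addn_gt0 ?fact_gt0 // mul1r -natrM ler_nat.
have kk : (k`! * k ^ 2 <= n)%N.
  apply: leq_trans n_ge; rewrite !factS; nia.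
have : (n < (n %/ k).+1 * k)%N by rewrite ltn_ceil.
have := fact_gt0 k; nia.
Qed.
End Permutations.

(** * The case of at least two copies *)

Lemma fact_expn_le (j d : nat) : (j`! * j ^ d <= (j + d)`!)%N.
Proof.
elim: d => [|d IH]; first by rewrite addn0 expn0 muln1.
rewrite addnS factS expnSr mulnA mulnC leq_mul //.
by rewrite (leq_trans (leq_addr d j)).
Qed.

Lemma fact_le_expn (j d : nat) : ((j + d)`! <= j`! * (j + d) ^ d)%N.
Proof.
elim: d => [|d IH]; first by rewrite addn0 expn0 muln1.
rewrite addnS factS expnSr mulnA mulnC leq_mul //.
apply: leq_trans IH _; rewrite leq_mul2l; apply/orP; right.
by case: d => // d; rewrite leq_exp2r.
Qed.

(** The three roundings in [(n %/ k)./2] and [P %/ B] lose at most a factor [8]. *)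
Lemma half_quotients (n k P B f : nat) : (0 < k)%N -> (0 < B)%N -> (4 * k <= n)%N ->
  (2 * B <= P)%N -> (8 * k ^ 2 * f * B <= n * P)%N ->
  (k * f <= (n %/ k)./2 * (P %/ B))%N.
Proof.
move=> k0 B0 kn BP H.
have nk : (n <= 4 * k * (n %/ k)./2)%N.
  have := ltn_ceil n k0; set N := (n %/ k)%N => nN.
  have N4 : (4 <= N)%N by rewrite leq_divRL.
  have := odd_double_half N; case: (odd N) => NE; nia.
have Pb : (P <= 2 * B * (P %/ B))%N.
  have := ltn_ceil P B0; set y := (P %/ B)%N => Py; nia.
have kB : (0 < 8 * k * B)%N by rewrite !muln_gt0 k0.
rewrite -(leq_pmul2l kB).
apply: (@leq_trans (8 * k ^ 2 * f * B)%N).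
  by rewrite -mulnn; nia.
apply: leq_trans H _; apply: leq_trans (leq_mul nk Pb) _.
nia.
Qed.

Section Multisets.
Variable R : realType.
Local Notation E := (expected_longest_run R).

(** Beyond [j] letters every further letter of a run costs a factor at least [j],
    and [d] further letters are too expensive when [j ^ d >= m ^ (j + d)]; this
    holds for the first [d] above [2 * j * ln m / ln j]. *)
Lemma expected_multi_le (m j n : nat) : (1 < m)%N -> (1 < j)%N -> (2 * m <= j)%N ->
  4 * ln m%:R <= ln j%:R :> R -> (n <= j`!)%N ->
  E m n <= j%:R + 2 * (j%:R * ln m%:R / ln j%:R) + 2.
Proof.
move=> m1 j1 mj ln_mj n_le.
have lnm_gt0 : 0 < ln m%:R :> R by rewrite ln_gt0 // ltr1n.
have lnj_gt0 : 0 < ln j%:R :> R by rewrite ln_gt0 // ltr1n.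
have m0 : 0 < m%:R :> R by rewrite ltr0n ltnW.
have j0 : 0 < j%:R :> R by rewrite ltr0n ltnW.
set r := _ / ln j%:R.
have r0 : 0 <= r by rewrite divr_ge0 ?mulr_ge0 // ltW.
have rE : r * ln j%:R = j%:R * ln m%:R by rewrite divfK // gt_eqF.
have r4 : 4 * r <= j%:R.
  by rewrite -(ler_pM2r lnj_gt0) -mulrA rE mulrCA ler_wpM2l.
pose D := (Num.truncn (2 * r)).+1.
have r2 : 0 <= 2 * r by lra.
have rD : 2 * r < D%:R by apply: truncnS_gt.
have Dr : D%:R <= 2 * r + 1 by rewrite /D -natr1 lerD2r truncn_le.
have Dj : D%:R <= j%:R :> R.
  have : 2 <= j%:R :> R by rewrite ler_nat.
  lra.
clearbody D; have Kle : (n * m ^ (j + D) <= (j + D)`!)%N.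
  apply: leq_trans (fact_expn_le j D); apply: leq_mul => //.
  rewrite -(ler_nat R) !natrX -ler_ln ?posrE ?exprn_gt0 // !lnXn //.
  rewrite -[leLHS]mulr_natr -[leRHS]mulr_natr natrD.
  have := ler_wpM2l (ltW lnm_gt0) Dj; have := ler_wpM2r (ltW lnj_gt0) (ltW rD); lra.
have := expected_le R m n (j + D).-1; rewrite prednK ?addn_gt0 ?(ltnW j1) // => /le_trans; apply.
under eq_bigr => k _ do rewrite -mulrA.
rewrite -mulr_sumr.
have tail := @factorial_tail_le R m (j + D) n.+1.
apply: le_trans (lerD (lexx _) (ler_wpM2l (ler0n _ _) (tail _))) _.
  by rewrite (leq_trans mj) // -addnS leq_addr.
have : n%:R * (m%:R ^+ (j + D) / (j + D)`!%:R) <= 1 :> R.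
  by rewrite mulrA ler_pdivrMr ?ltr0n ?fact_gt0 // mul1r -natrX -natrM ler_nat.
have : ((j + D).-1%:R : R) + 1 = j%:R + D%:R by rewrite natr1 prednK ?natrD // addn_gt0 (ltnW j1).
rewrite [n%:R * (2 * _)]mulrCA; move: (n%:R * _) ((j + D).-1%:R) => S u; lra.
Qed.

End Multisets.

Lemma mul8_le_fact (j : nat) : (12 <= j)%N -> (8 * j <= j.-1`!)%N.
Proof.
case: j => [//|[//|[//|i]]] i_ge.
by rewrite !factS; move: i_ge (fact_gt0 i); clear; nia.
Qed.

Section MultisetsLower.
Variable R : realType.
Local Notation E := (expected_longest_run R).

Lemma ln2_ge : 2^-1 <= ln 2 :> R.
Proof.
have half_gtN1 : -1 < - 2^-1 :> R by lra.
have := le_ln1Dx half_gtN1; have -> : 1 + - 2^-1 = 2^-1 :> R by lra.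
by rewrite lnV ?posrE //; lra.
Qed.

(** In logarithms the left side is at most [2 * (d + 4 + M) * ln j], where the choice
    of [d] bounds [8 * d * ln j] by [j * ln m] and [M * ln j] is negligible. *)
Lemma exponent_le (m j d M : nat) : (1 < m)%N -> (12 <= j)%N ->
  100 * (Num.sqrt j%:R * ln j%:R) <= j%:R :> R ->
  d%:R <= j%:R * ln m%:R / ln j%:R / 8 :> R -> M%:R <= Num.sqrt j%:R :> R ->
  ((3 * j) ^ (d + 4 + M) <= m ^ (j + d)./2)%N.
Proof.
move=> m1 j12 sLj d_le M_le.
have j0 : 0 < j%:R :> R by rewrite ltr0n (leq_trans _ j12).
have j12R : 12 <= j%:R :> R by rewrite ler_nat.
have m0 : 0 < m%:R :> R by rewrite ltr0n ltnW.
have m2 : 2 <= m%:R :> R by rewrite ler_nat.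
have lnm : 2^-1 <= ln m%:R :> R by apply: le_trans ln2_ge _; rewrite ler_ln ?posrE.
have lnj : 2^-1 <= ln j%:R :> R.
  by apply: le_trans ln2_ge _; rewrite ler_ln ?posrE //; lra.
have ln3j : ln (3 * j%:R) <= 2 * ln j%:R :> R.
  rewrite lnM ?posrE // mulr_natl mulr2n lerD2r ler_ln ?posrE //; lra.
have dj : 8 * (d%:R * ln j%:R) <= j%:R * ln m%:R :> R.
  move: d_le; rewrite ler_pdivlMr // ler_pdivlMr; last lra.
  by move=> H; apply: le_trans H; rewrite mulrAC mulrC.
have sj : Num.sqrt j%:R * Num.sqrt j%:R = j%:R :> R by rewrite -expr2 sqr_sqrtr // ltW.
have s1 : 1 <= Num.sqrt j%:R :> R by rewrite -[leLHS]sqrtr1 ler_wsqrtr //; lra.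
have half : (j%:R - 1) / 2 <= ((j + d)./2)%:R :> R.
  rewrite ler_pdivrMr // -natrM lerBlDr -(natrD _ _ 1%N) ler_nat.
  apply: leq_trans (leq_addr d j) _; rewrite muln2 -{1}(odd_double_half (j + d)) addnC.
  by rewrite leq_add2l; case: odd.
have j3 : 0 < 3 * j%:R :> R by lra.
rewrite -(ler_nat R) !natrX natrM -ler_ln ?posrE ?exprn_gt0 // !lnXn //.
rewrite -[leLHS]mulr_natr -[leRHS]mulr_natr !natrD.
move: (ln (3 * j%:R)) ((j + d)./2%:R) ln3j half => A H ln3j half.
have d0 : 0 <= d%:R :> R by [].
have M0 : 0 <= M%:R :> R by [].
move: (d%:R) (M%:R) (ln m%:R) (j%:R) (Num.sqrt j%:R) (ln j%:R)
  s1 sLj dj M_le lnm lnj ln3j half d0 M0 j12R sj {d_le j3 j0}.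
move=> D N lm x s L s1 sLx dx Ns lm2 L2 AL Hx D0 N0 x12 sx.
have h1 : A * (D + 4 + N) <= 2 * L * (D + 4 + N) by rewrite ler_wpM2r //; lra.
have h2 : L * N <= L * s by rewrite ler_wpM2l //; lra.
have h3 : L * 1 <= L * s by rewrite ler_wpM2l //; lra.
have h4 : lm * ((x - 1) / 2) <= lm * H by rewrite ler_wpM2l //; lra.
have h5 : 2^-1 * (x / 4 - 2^-1) <= lm * (x / 4 - 2^-1) by rewrite ler_wpM2r //; lra.
lra.
Qed.

(** Blocks of length [k = j + d], where [d] is the integer part of
    [j * ln m / (8 * ln j)], and about [sqrt j] windows.  The loss
    [32 * m ^ 2 * sqrt j] comes from the words with too many crowded letters. *)
Lemma expected_multi_ge (m j n : nat) : (1 < m)%N -> (12 <= j)%N ->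
  (m <= j)%N -> 100 * (Num.sqrt j%:R * ln j%:R) <= j%:R :> R -> (j.-1`! <= n)%N ->
  j%:R + j%:R * ln m%:R / ln j%:R / 8 - 2 - 32 * m%:R ^+ 2 * Num.sqrt j%:R <= E m n.
Proof.
move=> m1 j12 le_mj big_j n_ge.
have m_gt0 : (0 < m)%N by apply: ltnW.
have j_gt0 : (0 < j)%N by apply: leq_trans j12.
have j0 : 0 < j%:R :> R by rewrite ltr0n.
have m2 : 2 <= m%:R :> R by rewrite ler_nat.
have lnm : 2^-1 <= ln m%:R :> R by apply: le_trans ln2_ge _; rewrite ler_ln ?posrE //; lra.
have lnj : 2^-1 <= ln j%:R :> R.
  by apply: le_trans ln2_ge _; rewrite ler_ln ?posrE // ler_nat (leq_trans _ j12).
have sj : Num.sqrt j%:R * Num.sqrt j%:R = j%:R :> R by rewrite -expr2 sqr_sqrtr // ltW.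
have s1 : 1 <= Num.sqrt j%:R :> R by rewrite -[leLHS]sqrtr1 ler_wsqrtr // ler1n.
have mj : m%:R <= j%:R :> R by rewrite ler_nat.
set r := _ / ln j%:R.
have r0 : 0 <= r / 8 by rewrite !divr_ge0 ?mulr_ge0 //; lra.
have r_le : r <= j%:R.
  rewrite ler_pdivrMr; last lra.
  by rewrite ler_wpM2l ?(ltW j0) // ler_ln ?posrE //; lra.
have := truncn_itv r0; move: (Num.truncn (r / 8)) => d /andP[d_le d_gt].
have := truncn_itv (le_trans ler01 s1); move: (Num.truncn _) => M /andP[M_le M_gt].
(* [d] is the surplus over [j], and [M.+1] the number of windows. *)
have key := exponent_le m1 j12 big_j d_le M_le.
have dj : (8 * d <= j)%N by rewrite -(ler_nat R) natrM; lra.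
have Mj : (M <= j)%N by rewrite -(ler_nat R) -sj; nra.
pose k := (j + d)%N.
have k2j : (k <= 2 * j)%N by move: dj; rewrite /k; clear; lia.
have k_gt0 : (0 < k)%N by rewrite /k addn_gt0 j_gt0.
have n8j : (8 * j <= n)%N.
  exact: leq_trans (mul8_le_fact j12) n_ge.
pose P := (m ^ k./2)%N; pose B := ((k + M) ^ M)%N.
have B_gt0 : (0 < B)%N by rewrite expn_gt0 addn_gt0 k_gt0.
have B_le : (B <= (3 * j) ^ M)%N.
  rewrite /B; case: (M) Mj => // M' Mj; rewrite leq_exp2r //; move: k2j Mj; clear; lia.
have kd : (k ^ d.+1 <= (3 * j) ^ d.+1)%N by rewrite leq_exp2r //; move: k2j; clear; lia.
have P_ge : (8 * k ^ 2 * k ^ d.+1 * B <= P)%N.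
  apply: leq_trans key.
  have k3 : (k <= 3 * j)%N by move: k2j; clear; lia.
  have k22 : (k ^ 2 <= (3 * j) ^ 2)%N by rewrite leq_exp2r.
  have e8 : (8 <= 3 * j)%N by move: j12; clear; lia.
  have := leq_mul (leq_mul e8 k22) (leq_mul kd B_le).
  move: (3 * j)%N => b; rewrite -expnS -!expnD mulnA => /leq_trans; apply.
  by have -> : (3 + (d.+1 + M) = d + 4 + M)%N by clear; lia.
have P2B : (2 * B <= P)%N.
  apply: leq_trans P_ge; rewrite leq_mul2r; apply/orP; right.
  by rewrite (leq_trans (_ : 2 <= 8 * 1 * 1)%N) // !leq_mul // expn_gt0 k_gt0.
have kfact : (k`! <= j.-1`! * k ^ d.+1)%N.
  by have := fact_le_expn j.-1 d.+1; rewrite addnS -addSn prednK.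
have nP : (8 * k ^ 2 * k`! * B <= n * P)%N.
  apply: leq_trans (leq_mul n_ge P_ge).
  have XE X : (X * (j.-1`! * k ^ d.+1) * B = j.-1`! * (X * k ^ d.+1 * B))%N.
    by rewrite mulnCA -mulnA.
  by rewrite -XE leq_mul2r leq_mul2l kfact !orbT.
have n4k : (4 * k <= n)%N by move: k2j n8j; clear; lia.
have half := half_quotients k_gt0 B_gt0 n4k P2B nP.
(* [M.+1] windows of [l] positions each cover the [m * n] positions. *)
pose N := (n %/ k)%N; pose l := (m * n %/ M.+1).+1.
have Nk_le : (N * k <= n)%N := leq_trunc_div n k.
have N_gt0 : (0 < N)%N by rewrite divn_gt0 // (leq_trans _ n4k) // leq_pmull.
have n_gt0 : (0 < n)%N by rewrite (leq_trans _ n8j) // muln_gt0.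
have Nk_ge : (n <= 2 * (N * k))%N.
  by have := ltn_ceil n k_gt0; rewrite -/N; move: n4k; clear; rewrite mulSn; lia.
have Ml : (m * n <= M.+1 * l)%N by rewrite [X in (_ <= X)%N]mulnC; apply/ltnW/ltn_ceil.
have l_le : (M.+1 * l <= 2 * (m * n))%N.
  have := leq_trunc_div (m * n) M.+1; rewrite /l mulnS [(M.+1 * _)%N]mulnC.
  have : (M.+1 <= m * n)%N.
    apply: leq_trans (leq_pmull n m_gt0); move: Mj n8j j12; clear; lia.
  move: (m * n %/ M.+1 * M.+1)%N (m * n)%N; clear; lia.
have := expected_ge R m Nk_le; apply: le_trans.
have := @avoiding_ratio_le R m n N k M l Nk_le k_gt0 N_gt0 m_gt0 isT Ml.
set p := (_ / _ : R); set p1 := (_ / _ : R); set p2 := (_ / _ : R) => p_le.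
have k0R : 0 <= k%:R :> R by [].
have p2_le : k%:R * p2 <= 1.
  rewrite /p2 mulrA ler_pdivrMr ?ltr0n ?addn_gt0 ?fact_gt0 // mul1r -natrM ler_nat.
  exact: leq_trans half (leq_addl _ _).
(* [p1] bounds the probability that too many letters are crowded, [p2] the
   probability that all blocks fail otherwise. *)
have p1_le : p1 * Num.sqrt j%:R <= 16 * m%:R ^+ 2.
  rewrite /p1 mulrAC ler_pdivrMr; last by rewrite ltr0n muln_gt0 N_gt0.
  apply: (@le_trans _ _ ((4 * (l * m))%:R * M.+1%:R)); first by rewrite ler_wpM2l // ltW.
  rewrite -natrX -!natrM ler_nat.
  have -> : (4 * (l * m) * M.+1 = 4 * m * (M.+1 * l))%N by move: (l) (M) (m); clear; lia.
  have := leq_mul (leqnn (8 * m * m)) Nk_ge; have := leq_mul (leqnn (4 * m)) l_le.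
  rewrite -mulnn; move: (M.+1 * l)%N (N * k)%N (m) (n); clear; lia.
have p1_ge0 : 0 <= p1 by rewrite divr_ge0.
have kp1 : k%:R * p1 <= 32 * m%:R ^+ 2 * Num.sqrt j%:R.
  apply: (@le_trans _ _ (2 * j%:R * p1)).
    by rewrite ler_wpM2r // -natrM ler_nat.
  have -> : 2 * j%:R * p1 = 2 * Num.sqrt j%:R * (p1 * Num.sqrt j%:R).
    by rewrite -{1}sj; ring.
  apply: le_trans (ler_wpM2l (_ : 0 <= 2 * Num.sqrt j%:R) p1_le) _.
    by rewrite mulr_ge0 ?sqrtr_ge0.
  by rewrite le_eqVlt; apply/orP; left; apply/eqP; ring.
have : k%:R * p <= k%:R * p1 + k%:R * p2 by rewrite -mulrDr ler_wpM2l.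
have : k%:R = j%:R + d%:R :> R by rewrite /k natrD.
have : r / 8 <= d%:R + 1 by rewrite natr1 ltW.
rewrite mulrBr mulr1; move: p2_le kp1.
move: (k%:R) (d%:R) (j%:R) (32 * m%:R ^+ 2 * Num.sqrt j%:R)
  (k%:R * p2) (k%:R * p1) (k%:R * p) (r / 8).
clear=> *; lra.
Qed.
End MultisetsLower.

(** * Conclusion *)

(** The logarithm of [j] is four times that of its fourth root, hence at most four
    times that root. *)
Lemma ln_le_sqrt (R : realType) (A : R) : 0 < A ->
  exists J, forall j, (J <= j)%N -> A * ln j%:R <= Num.sqrt j%:R.
Proof.
move=> A0; exists (Num.truncn ((A * 4) ^+ 4)).+1 => j Jj.
have j_gt : (A * 4) ^+ 4 < j%:R.
  by apply: lt_le_trans (truncnS_gt _) _; rewrite ler_nat.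
have A4 : 0 < A * 4 by rewrite mulr_gt0.
have j0 : 0 < j%:R :> R by apply: lt_trans j_gt; rewrite exprn_gt0.
pose s := Num.sqrt (j%:R : R); pose t := Num.sqrt s.
have s0 : 0 < s by rewrite sqrtr_gt0.
have t0 : 0 < t by rewrite sqrtr_gt0.
have tt : t ^+ 2 = s by rewrite sqr_sqrtr // ltW.
have ss : s ^+ 2 = j%:R by rewrite sqr_sqrtr // ltW.
have At : A * 4 <= t.
  rewrite -(ler_pXn2r (n := 4)) // ?nnegrE ?(ltW A4) ?(ltW t0) // (exprM t 2 2) tt ss.
  exact: ltW.
rewrite -/s -ss -tt -exprM lnXn // -[ln t *+ _]mulr_natr.
have lnt : ln t <= t by apply/ltW/ln_sublinear.
rewrite expr2; have := ler_wpM2l (ltW A4) lnt; have := ler_wpM2r (ltW t0) At; lra.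
Qed.

Theorem theorem1p3 (R : realType) :
  exists c C : R, [/\ 0 < c, 0 < C &
    forall m : nat, (1 <= m)%N ->
    exists N : nat, forall n : nat, (N <= n)%N ->
      let x : R := inv_Gamma R n in
      let err : R := 1 + ln m%:R / ln x * x in
      c * err <= `| expected_longest_run R m n - x | <= C * err].
Proof.
exists (32^-1), 5; split=> // m m_gt0.
have m0 : 0 < m%:R :> R by rewrite ltr0n.
have [J JP] := @ln_le_sqrt R (32 * 36 * m%:R ^+ 2) ltac:(by rewrite mulr_gt0 ?exprn_gt0).
(* [m ^ 4 <= j] gives [4 * ln m <= ln j], so that all surpluses over [j] are at most
   [j]; beyond [2 * m] the terms [m ^ k / k!] halve at each step. *)
pose J0 := maxn (maxn J (m ^ 4)) (maxn (2 * m) 12).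
exists (J0`!.+2) => n n_ge.
have n_gt1 : (1 < n)%N by apply: leq_trans n_ge.
have [i [q [xE /andP[q0 q1] fact_le le_n]]] := inv_Gamma_itv R n_gt1.
pose j := i.+2.
have n_le : (n <= j`!)%N.
  rewrite -(ler_nat R); apply: le_trans le_n _.
  have : i.+1`!%:R <= i.+2`!%:R :> R by rewrite ler_nat ltnW // ltn_fact.
  rewrite -/j; move: (i.+1`!%:R) (j`!%:R) => a b ab; nra.
have J0j : (J0 < j)%N.
  rewrite ltnNge leq_eqVlt; apply/negP => /orP[/eqP jE|jJ].
    by move: n_ge; rewrite -jE => /(leq_trans (leqnSn _)); rewrite ltnNge n_le.
  have := leq_trans n_ge n_le; rewrite ltnNge => /negP[].
  by rewrite (leq_trans (ltnW (ltn_fact _ jJ))).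
have [Jj m4j] : (J <= j)%N /\ (m ^ 4 <= j)%N.
  by move: J0j; rewrite /J0; move: (m ^ 4)%N; clear; lia.
have [mj j12] : (2 * m <= j)%N /\ (12 <= j)%N.
  by move: J0j; rewrite /J0; move: (m ^ 4)%N; clear; lia.
have ln_j := JP j Jj.
cbv zeta.
rewrite xE.
have j12R : 12 <= j%:R :> R by rewrite ler_nat.
case: (leqP m 1) => [m1|m1].
  have {m_gt0 m1}-> : m = 1%N by apply/eqP; rewrite eqn_leq m1.
  rewrite ln1 !mul0r addr0 !mulr1.
  have i4 : (4 <= i)%N by move: j12; rewrite /j; clear; lia.
  have iE : i.+2%:R = i%:R + 2 :> R by rewrite -addn2 natrD.
  have q01 : 0 <= q <= 1 by rewrite q0 ltW.
  have := expected1_le i4 q01 le_n; have := expected1_ge R (leq_trans (isT : 0 < 4)%N i4) fact_le.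
  have : 3 / i.+2%:R <= 4^-1 :> R.
    by rewrite ler_pdivrMr // -/j; move: j12R; move: (j%:R) => jr; lra.
  move: (expected_longest_run R 1 n) (3 / i.+2%:R) => e v v_le e_ge e_le.
  have H : e - (i.+2%:R + q) <= - 32^-1 by rewrite iE; move: (i%:R) iE e_ge e_le => y *; lra.
  have H' : - 5 <= e - (i.+2%:R + q) by rewrite iE; move: (i%:R) iE e_ge e_le => y *; lra.
  rewrite ler0_norm; last by apply: le_trans H _; lra.
  by move: (e - _) H H' => z *; lra.
have m2 : 2 <= m%:R :> R by rewrite ler_nat.
have lnm : 2^-1 <= ln m%:R :> R by apply: le_trans (ln2_ge R) _; rewrite ler_ln ?posrE //; lra.
have lnj : 2^-1 <= ln j%:R :> R.
  by apply: le_trans (ln2_ge R) _; rewrite ler_ln ?posrE //; lra.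
have j0 : 0 < j%:R :> R by lra.
pose s := Num.sqrt (j%:R : R).
have sj : s * s = j%:R by rewrite -expr2 sqr_sqrtr // ltW.
have s0 : 0 < s by rewrite sqrtr_gt0.
have m2sq : 4 <= m%:R ^+ 2 :> R.
  by rewrite expr2; have := ler_pM (ler0n R 2) (ler0n R 2) m2 m2; lra.
have ln_jm : 4 * ln m%:R <= ln j%:R :> R.
  have -> : 4 * ln m%:R = ln (m%:R ^+ 4) :> R by rewrite lnXn // -[RHS]mulr_natr mulrC.
  by rewrite -natrX ler_ln ?posrE ?ltr0n ?expn_gt0 ?m_gt0 // ler_nat.
have sL : 100 * (s * ln j%:R) <= j%:R.
  have h : 4 * ln j%:R <= m%:R ^+ 2 * ln j%:R :> R by rewrite ler_wpM2r //; lra.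
  have h1 : 100 * ln j%:R <= s by move: ln_j h; rewrite -/s -!mulrA; move: (_ * ln _) => y *; lra.
  by rewrite -[leRHS]sj mulrCA ler_wpM2l // ltW.
set E := expected_longest_run R m n.
pose r : R := j%:R * ln m%:R / ln j%:R.
have up : E <= j%:R + 2 * r + 2.
  exact: (expected_multi_le m1 (isT : (1 < j)%N) mj ln_jm n_le).
have lo : j%:R + r / 8 - 2 - 32 * m%:R ^+ 2 * s <= E.
  have le_mj : (m <= j)%N by apply: leq_trans mj; rewrite leq_pmull.
  exact: (expected_multi_ge m1 j12 le_mj sL fact_le).
have r_ge : 36 * (m%:R ^+ 2 * s) <= r / 16.
  rewrite ler_pdivlMr // ler_pdivlMr; last by lra.
  have h : s * (32 * 36 * m%:R ^+ 2 * ln j%:R) <= s * s by rewrite ler_wpM2l // ltW.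
  have h' := ler_wpM2l (ltW j0) lnm.
  by rewrite sj in h; lra.
set x := i.+2%:R + q; have xE' : x = j%:R + q by [].
have x0 : 0 < x by lra.
have lnx_ge : ln j%:R <= ln x by rewrite ler_ln ?posrE //; lra.
have lnx_le : ln x <= 2 * ln j%:R.
  have -> : 2 * ln j%:R = ln (j%:R ^+ 2) :> R by rewrite lnXn // -[RHS]mulr_natr mulrC.
  rewrite ler_ln ?posrE ?exprn_gt0 // expr2.
  have := ler_wpM2l (ltW j0) j12R; lra.
have lnj0 : 0 < ln j%:R :> R by lra.
have lnx0 : 0 < ln x by lra.
have lnm0 : 0 < ln m%:R :> R by lra.
(* As [j <= x <= j + 1], the second term of the error is between [r / 2] and
   [2 * r]. *)
have vr : ln m%:R / ln x * x <= 2 * r.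
  have -> : 2 * r = ln m%:R / ln j%:R * (2 * j%:R) by rewrite /r; ring.
  apply: ler_pM; [by rewrite divr_ge0 // ltW|exact: ltW| |lra].
  by rewrite ler_wpM2l ?(ltW lnm0) // lef_pV2 ?posrE.
have rv : r / 2 <= ln m%:R / ln x * x.
  have -> : r / 2 = ln m%:R / (2 * ln j%:R) * j%:R by rewrite /r invfM; ring.
  apply: ler_pM; [by rewrite divr_ge0 // ltW // mulr_gt0|exact: ltW| |lra].
  by rewrite ler_wpM2l ?(ltW lnm0) // lef_pV2 ?posrE // mulr_gt0.
have s1 : 1 <= s by rewrite -[leLHS]sqrtr1 ler_wsqrtr //; lra.
have ms : 4 <= m%:R ^+ 2 * s by have := ler_pM (ler0n R 4) ler01 m2sq s1; lra.
have Ex : (1 + 2 * r) / 32 <= E - x.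
  have : 32 * m%:R ^+ 2 * s + 4 * (m%:R ^+ 2 * s) = 36 * (m%:R ^+ 2 * s) by ring.
  move: (m%:R ^+ 2 * s) (32 * m%:R ^+ 2 * s) r_ge ms lo => a b *; lra.
have r0 : 0 <= r by rewrite divr_ge0 ?mulr_ge0 // ltW.
have Ex2 : E - x <= 2 * r + 2 by lra.
rewrite ger0_norm; last by apply: le_trans Ex; rewrite divr_ge0 //; lra.
move: (E - x) (ln m%:R / ln x * x) Ex Ex2 vr rv r0 => z v; move: (r).
by clear=> r' *; lra.
Qed.
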